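(* Let $d\ge2$ and let $f\in C^\alpha(\mathbb{R})$ ($\alpha>0$) be $1$-periodic and non-constant. There is a non-empty set $\mathcal F\subset C(\partial B_1\cap\{x_1\ge0\})$, open in the uniform topology, such that for all $g\in\mathcal F$ the unique minimal supersolution $u_g$ of $$\Delta u=0\ \text{ in }B_1^+,\qquad \partial_1u\in[L_*(\nabla'u),L^*(\nabla'u)]\ \text{ on }B_1',$$ with $u_g=g$ on $\partial B_1\cap\{x_1\ge0\}$ has a non-empty contact set $\mathcal C(u_g)\neq\emptyset$, which is relatively open in $B_1'$.
   Context: Notation: $x=(x_1,x')\in\mathbb{R}\times\mathbb{R}^{d-1}$; $B_1$ is the open unit ball of $\mathbb{R}^d$, $B_1^+=B_1\cap\{x_1>0\}$, $B_1'=B_1\cap\{x_1=0\}$; $\nabla'$ is the gradient in $x'$. $\langle f\rangle=\int_0^1f(v)\,dv$, $L_*(p)=(\min f)1_{\{p=0\}}+\langle f\rangle1_{\{p\ne0\}}$, $L^*(p)=(\max f)1_{\{p=0\}}+\langle f\rangle1_{\{p\ne0\}}$ for $p\in\mathbb{R}^{d-1}$. A smooth $\phi$ touches $u$ from below at $x_0\in B_1^+\cup B_1'$ if $u-\phi$ has a local minimum equal to $0$ at $x_0$ relative to $B_1^+\cup B_1'$. A supersolution of the problem is a lower semicontinuous $u$ on $\overline{B_1^+}$ such that whenever smooth $\phi$ touches $u$ from below at $x\in B_1^+\cup B_1'$, either $\Delta\phi(x)\le0$, or $x\in B_1'$ and $\partial_1\phi(x)\le L^*(\nabla'\phi(x))$.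 The minimal supersolution $u_g$ with data $g$ is the pointwise infimum of all supersolutions $u$ with $u\ge g$ on $\partial B_1\cap\{x_1\ge0\}$. The contact set (formally $\{\partial_1u\ne\langle f\rangle\}$) of the minimal supersolution is $\mathcal C(u_g)=\{x\in B_1':\ \text{there is a smooth }\phi\text{ touching }u_g\text{ from below at }x\text{ with }\partial_1\phi(x)>\langle f\rangle\}$. *)

(* Defs.v *)
From HB Require Import structures.
From mathcomp Require Import all_boot all_order all_algebra.
From mathcomp Require Import all_classical all_reals all_analysis.
Set Implicit Arguments.
Unset Strict Implicit.
Unset Printing Implicit Defensive.
Import Order.TTheory GRing.Theory Num.Theory.
Import numFieldNormedType.Exports.
Local Open Scope classical_set_scope.
Local Open Scope ring_scope.

(* The dimension is d = n.+1: x_1 is the coordinate of index 0 and x' collects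
   the coordinates of index lift ord0 j, j < n. *)

Section Geometry.
Context {R : realType}.
Variable n : nat.
Implicit Type x : 'rV[R]_n.+1.

(* The norm that the library puts on row vectors is the sup norm; it gives the
   right topology but not the Euclidean ball. *)
Definition enorm x : R := Num.sqrt (\sum_i (x ord0 i) ^+ 2).

Definition half_ball : set 'rV[R]_n.+1 :=
  [set x | enorm x < 1 /\ 0 < x ord0 ord0].

Definition flat_ball : set 'rV[R]_n.+1 :=
  [set x | enorm x < 1 /\ x ord0 ord0 = 0].

Definition half_sphere : set 'rV[R]_n.+1 :=
  [set x | enorm x = 1 /\ 0 <= x ord0 ord0].

End Geometry.
Arguments half_ball R n : clear implicits.
Arguments flat_ball R n : clear implicits.
Arguments half_sphere R n : clear implicits.

Section Calculus.
Context {R : realType} {n : nat}.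
Implicit Types (phi : 'rV[R]_n.+1 -> R) (x : 'rV[R]_n.+1).

Definition partial (i : 'I_n.+1) phi x : R := 'D_(delta_mx ord0 i) phi x.

(* phi is of class C^k on the whole space: all iterated partial derivatives of
   order at most k exist and are continuous. *)
Fixpoint class_C (k : nat) phi : Prop :=
  continuous phi /\
  if k is k'.+1 then
    forall i, (forall x, derivable phi x (delta_mx ord0 i)) /\
              class_C k' (partial i phi)
  else True.

Definition smooth phi : Prop := forall k, class_C k phi.

Definition laplacian phi x : R := \sum_i partial i (partial i phi) x.

Definition tangential_gradient phi x : 'rV[R]_n :=
  \row_j partial (lift ord0 j) phi x.

End Calculus.

Section Coefficient.
Context {R : realType}.
Implicit Type f : R -> R.

(* f is in C^alpha, alpha > 0: writing alpha = k + beta with 0 < beta <= 1, f is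
   k times differentiable and its k-th derivative is beta-Hoelder.  For an
   integer alpha = k.+1 this is C^{k,1}, which contains the periodic functions
   of class C^{k+1}.  Boundedness is not required: it is automatic for the
   periodic functions considered here. *)
Definition holder_class (alpha : R) f : Prop :=
  exists (k : nat) (beta : R),
    [/\ alpha = k%:R + beta, 0 < beta <= 1,
        forall j, (j < k)%N -> forall x, derivable (derive1n j f) x 1 &
        exists C : R, forall x y,
          `|derive1n k f x - derive1n k f y| <= C * `|x - y| `^ beta].

Definition mean f : R := \int[lebesgue_measure]_(v in `[0, 1]) f v.

(* For f continuous and periodic, sup (range f) is attained: it is max f. *)
Definition Lsup {n : nat} f (p : 'rV[R]_n) : R :=
  if p == 0 then sup (range f) else mean f.

End Coefficient.

Section Supersolutions.
Context {R : realType} {n : nat}.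
Implicit Types (f : R -> R) (u v g phi : 'rV[R]_n.+1 -> R).

Definition touches_below phi u (x0 : 'rV[R]_n.+1) : Prop :=
  u x0 = phi x0 /\
  \forall x \near within (half_ball R n `|` flat_ball R n) (nbhs x0),
    phi x <= u x.

Definition supersolution f u : Prop :=
  lower_semicontinuous
    (fun x : subspace (closure (half_ball R n)) => (u x)%:E) /\
  forall phi x, (half_ball R n `|` flat_ball R n) x ->
    smooth phi -> touches_below phi u x ->
    laplacian phi x <= 0 \/
    (flat_ball R n x /\
     partial ord0 phi x <= Lsup f (tangential_gradient phi x)).

Definition supersolutions_above f g : set ('rV[R]_n.+1 -> R) :=
  [set v | supersolution f v /\
           forall x, half_sphere R n x -> g x <= v x].

(* The values outside the closed half ball are irrelevant. *)
Definition inf_supersolution f g (x : 'rV[R]_n.+1) : R :=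
  inf [set v x | v in supersolutions_above f g].

(* Such a u is unique on the closed half ball. *)
Definition minimal_supersolution f g u : Prop :=
  [/\ supersolution f u,
      forall x, half_sphere R n x -> u x = g x &
      forall v, supersolutions_above f g v ->
        forall x, closure (half_ball R n) x -> u x <= v x].

Definition contact_set f u : set 'rV[R]_n.+1 :=
  [set x | flat_ball R n x /\
           exists phi, [/\ smooth phi, touches_below phi u x &
                           mean f < partial ord0 phi x]].

Definition boundary_data : set {uniform` half_sphere R n -> R} :=
  [set g | {within half_sphere R n, continuous g}].

End Supersolutions.
Arguments boundary_data R n : clear implicits.

(* Main.v *)
Require Import Defs.
From HB Require Import structures.
From mathcomp Require Import all_boot all_order all_algebra.
From mathcomp Require Import all_classical all_reals all_analysis.
From mathcomp Require Import ring lra.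
Set Implicit Arguments.
Unset Strict Implicit.
Unset Printing Implicit Defensive.
Import Order.TTheory GRing.Theory Num.Theory.
Import numFieldNormedType.Exports.
Local Open Scope classical_set_scope.
Local Open Scope ring_scope.

(** The supremum of the normal derivative allowed at a flat point is [<f>], except
    where the tangential gradient vanishes: there it is [max f], and
    [<f> < max f] for a non-constant [f] ([mean_lt_sup]). This gap is what creates
    contact points; comparison with quadratic polynomials does the rest.

    Existence and minimality hold for all continuous data [g], by Perron's method
    ([minimal_inf_supersolution]). The lower semicontinuous envelope of the
    infimum of the supersolutions above [g] is a supersolution: a test function
    violating this could be made strictly touching, and its translates would touch
    a competitor nearby; the upper semicontinuity of [L^*] is used here
    ([strict_at_stable]). The envelope keeps the data because the ball is strictly
    convex, so that at every point of the half sphere, equator included, there is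
    a strict subsolution close to [g] there and below [g] elsewhere
    ([lower_barrier]).

    The contact set of any supersolution is relatively open
    ([contact_set_open]). At a contact point [x] the slope exceeds [<f>], so the
    tangential gradient of the test function is zero, and by Taylor's formula the
    test function can be replaced with a paraboloid
    [b x_1 + K x_1^2 - L |(y - x)'|^2] with [b > <f>] and positive Laplacian
    ([contact_paraboloid]). Shift its vertex to a nearby flat point [y]: the
    difference still has a local minimum, which is neither interior, as the
    Laplacian is positive, nor at a flat point other than [y], as the tangential
    gradient of the paraboloid is nonzero there and its slope is larger than
    [<f>]. Hence the shifted paraboloid touches at [y], a contact point.

    For the contact set to be nonempty it suffices that the data lie between two
    explicit barriers. The function [max f * x_1] is a supersolution, having
    maximal slope and no tangential gradient, so [u_g <= 0] at the origin as soon
    as [g <= max f * x_1]. On the other hand a small quadratic [bump] of slope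
    larger than [<f>] and positive Laplacian can be positive at the origin and
    still lie strictly below [max f * x_1] on the half sphere. If [g] is above the
    bump, the minimum of [u_g] minus the bump is negative, so it is attained
    neither on the sphere nor in the interior: it is a contact point
    ([contact_set_nonempty]). A small uniform ball around a function between the
    two barriers provides the open set. *)

(** * Lower semicontinuous functions on compact sets *)

(** The sublevel sets of [h] at its values on [K] form a filter base; a cluster
    point of that filter is a minimum. *)
Lemma compact_lsc_min (R : realType) (T : topologicalType) (K : set T) (h : T -> R) :
  compact K -> K !=set0 ->
  (forall x a, K x -> a < h x -> \forall y \near x, K y -> a < h y) ->
  exists2 x, K x & forall y, K y -> h x <= h y.
Proof.
move=> cK [x0 Kx0] lsch.
pose F := filter_from K (fun y => K `&` [set z | h z <= h y]).
have FF : ProperFilter F.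
  apply: filter_from_proper; last by move=> y Ky; exists y; split => /=.
  apply: filter_from_filter; first by exists x0.
  move=> y z Ky Kz; have [yz|zy] := leP (h y) (h z).
    by exists y => // t [Kt ty]; do 2!split => //=; exact: le_trans ty _.
  exists z => // t [Kt tz]; do 2!split => //=.
  by rewrite /= in tz; exact: le_trans tz (ltW zy).
have [|x [Kx clx]] := cK F FF; first by exists x0 => // z [].
exists x => // y Ky; rewrite leNgt; apply/negP => yx.
have [|z [[Kz zy] /(_ Kz)]] := clx (K `&` [set z | h z <= h y])
    [set z | K z -> h y < h z] _ (lsch _ _ Kx yx); first by exists y.
by rewrite /= ltNge zy.
Qed.

(** * Smooth functions and diagonal quadratics *)

Section Calculus.
Context {R : realType} {n : nat}.
Local Notation X := 'rV[R]_n.+1.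
Implicit Types (phi psi : X -> R) (x y z : X) (i : 'I_n.+1).

Lemma smooth_continuous phi : smooth phi -> continuous phi.
Proof. by move=> /(_ 0%N) []. Qed.

Lemma smooth_derivable phi i x :
  smooth phi -> derivable phi x (delta_mx ord0 i).
Proof. by move=> /(_ 1%N) [_ /(_ i) []]. Qed.

Lemma smooth_partial phi i : smooth phi -> smooth (partial i phi).
Proof. by move=> sphi k; have [_ /(_ i) []] := sphi k.+1. Qed.

Lemma partialD phi psi i : smooth phi -> smooth psi ->
  partial i (phi + psi) = partial i phi + partial i psi.
Proof.
move=> sphi spsi; apply/funext => x.
by rewrite /partial deriveD//; exact: smooth_derivable.
Qed.

Lemma smoothD phi psi : smooth phi -> smooth psi -> smooth (phi + psi).
Proof.
have cD (f g : X -> R) : smooth f -> smooth g -> continuous (f + g).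
  move=> sf sg x; apply: (@continuousD _ _ _ f g).
    exact: (smooth_continuous sf).
  exact: (smooth_continuous sg).
move=> sphi spsi k; elim: k phi psi sphi spsi => [|k IHk] phi psi sphi spsi.
  by split => //; exact: cD.
split; first exact: cD.
move=> i; split => [x|]; first by apply: derivableD; exact: smooth_derivable.
by rewrite partialD//; apply: IHk; exact: smooth_partial.
Qed.

Lemma laplacianD phi psi x : smooth phi -> smooth psi ->
  laplacian (phi + psi) x = laplacian phi x + laplacian psi x.
Proof.
move=> sphi spsi; rewrite /laplacian -big_split; apply: eq_bigr => i _.
by rewrite !partialD//; exact: smooth_partial.
Qed.

Lemma continuous_fsum (F : 'I_n.+1 -> X -> R) :
  (forall i, continuous (F i)) -> continuous (fun x => \sum_i F i x).
Proof.
by move=> cF; apply: continuous_big => //; exact: add_continuous.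
Qed.

Lemma laplacian_continuous phi : smooth phi -> continuous (laplacian phi).
Proof.
move=> sphi; apply: continuous_fsum => i.
by apply: smooth_continuous; do 2!apply: smooth_partial.
Qed.

(** Partial derivatives are derivatives along coordinate lines, which gives
    access to the one-variable theory. *)
Lemma is_derive_line phi (v : X) x (t d : R) :
  is_derive (t *: v + x) v phi d <->
  is_derive t (1 : R) (fun s : R => phi (s *: v + x)) d.
Proof.
have E : (fun h : R => h^-1 *: (phi (h *: v + (t *: v + x)) - phi (t *: v + x)))
    = (fun h : R => h^-1 *: (phi ((h *: (1 : R) + t) *: v + x) - phi (t *: v + x))).
  by apply/funext => h; rewrite [h *: (1 : R)]mulr1 scalerDl addrA.
by split=> -[d1 d2]; split; move: d1 d2; rewrite /derivable /derive /= E.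
Qed.

(** A family closed under partial derivatives, hence made of smooth functions;
    all barriers and perturbations below belong to it. *)
Definition dquad (c : R) (b k : 'I_n.+1 -> R) x : R :=
  c + \sum_i (b i * x ord0 i + k i * x ord0 i ^+ 2).

Lemma dquad_continuous c b k : continuous (dquad c b k).
Proof.
have cs : continuous (fun x => \sum_i (b i * x ord0 i + k i * x ord0 i ^+ 2)).
  apply: continuous_fsum => i x.
  have cx : (fun z : X => z ord0 i) @ x --> x ord0 i by exact: coord_continuous.
  exact: cvgD (cvgM (cvg_cst (b i)) cx) (cvgM (cvg_cst (k i)) (cvgM cx cx)).
by move=> x; exact: cvgD (cvg_cst c) (cs x).
Qed.

Lemma dquad_is_derive c b k i x :
  is_derive x (delta_mx ord0 i : X) (dquad c b k)
    (b i + 2 * k i * x ord0 i).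
Proof.
rewrite -[X in is_derive X]add0r -(scale0r (delta_mx ord0 i)).
apply/is_derive_line.
have -> : (fun h : R => dquad c b k (h *: delta_mx ord0 i + x)) =
    (fun h : R => dquad c b k x + (b i + 2 * k i * x ord0 i) * h + k i * (h * h)).
  apply/funext => h; rewrite /dquad -!addrA; congr (_ + _).
  rewrite (bigD1 i)// [in RHS](bigD1 i)//= !mxE !eqxx mulr1.
  rewrite (eq_bigr (fun j => b j * x ord0 j + k j * x ord0 j ^+ 2)); first ring.
  by move=> j /negbTE ji; rewrite !mxE ji mulr0 add0r.
by apply: is_derive_eq; rewrite /GRing.scale/=; ring.
Qed.

Lemma partial_dquad c b k i : partial i (dquad c b k) =
  dquad (b i) (fun j => 2 * k j *+ (j == i)) (fun=> 0).
Proof.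
apply/funext => x; have [_ D] := dquad_is_derive c b k i x.
rewrite /partial D /dquad (bigD1 i)//= eqxx big1 ?mul0r ?addr0// => j /negbTE ->.
by rewrite mulr0n !mul0r addr0.
Qed.

Lemma partial_dquadE c b k i x :
  partial i (dquad c b k) x = b i + 2 * k i * x ord0 i.
Proof. by have [_] := dquad_is_derive c b k i x. Qed.

Lemma smooth_dquad c b k : smooth (dquad c b k).
Proof.
move=> m; elim: m c b k => [|m IHm] c b k; split => //=;
  try exact: dquad_continuous.
move=> i; split => [x|]; first by have [] := dquad_is_derive c b k i x.
by rewrite partial_dquad.
Qed.

Lemma laplacian_dquad c b k x : laplacian (dquad c b k) x = 2 * \sum_i k i.
Proof.
rewrite mulr_sumr; apply: eq_bigr => i _.
by rewrite partial_dquad partial_dquadE eqxx mulr1n mulr0 mul0r addr0.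
Qed.

Lemma smooth_cst c : smooth (cst c : X -> R).
Proof.
suff <- : dquad c (fun=> 0) (fun=> 0) = cst c by exact: smooth_dquad.
apply/funext => x; rewrite /dquad big1 ?addr0// => i _.
by rewrite !mul0r addr0.
Qed.

Lemma partial_cst c i : partial i (cst c : X -> R) = 0.
Proof. by apply/funext => x; rewrite /partial derive_cst. Qed.

Lemma partial_add_cst phi c i : smooth phi -> partial i (phi + cst c) = partial i phi.
Proof.
by move=> sphi; rewrite partialD ?partial_cst ?addr0//; exact: smooth_cst.
Qed.

Lemma laplacian_add_cst phi c : smooth phi ->
  laplacian (phi + cst c) = laplacian phi.
Proof.
move=> sphi; apply/funext => x; apply: eq_bigr => i _.
by rewrite partial_add_cst.
Qed.

End Calculus.

(** * The half ball *)

Section Geometry.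
Context {R : realType} {n : nat}.
Local Notation X := 'rV[R]_n.+1.
Implicit Types (x y z : X) (r : R).

(** Squared Euclidean distance: being a diagonal quadratic, it serves both as a
    gauge of neighbourhoods and as a perturbation of test functions. *)
Definition sqdist x y : R := \sum_i (y ord0 i - x ord0 i) ^+ 2.

Lemma sqdistE x : sqdist x =
  dquad (\sum_i x ord0 i ^+ 2) (fun i => - (2 * x ord0 i)) (fun=> 1).
Proof.
apply/funext => y; rewrite /dquad -big_split; apply: eq_bigr => i _ /=; ring.
Qed.

Lemma sqdist_continuous x : continuous (sqdist x).
Proof. rewrite sqdistE; exact: dquad_continuous. Qed.

Lemma sqdistxx x : sqdist x x = 0.
Proof. by rewrite /sqdist big1// => i _; rewrite subrr expr0n. Qed.

Lemma sqdist_ge0 x y : 0 <= sqdist x y.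
Proof. by apply: sumr_ge0 => i _; exact: sqr_ge0. Qed.

Lemma sqdist_coord x y i : (y ord0 i - x ord0 i) ^+ 2 <= sqdist x y.
Proof.
rewrite /sqdist (bigD1 i)//= lerDl; apply: sumr_ge0 => j _; exact: sqr_ge0.
Qed.

Lemma sqdist_ltI x r : sqdist 0 x < r -> \forall y \near x, sqdist 0 y < r.
Proof. by move=> xr; have /cvgr_lt := @sqdist_continuous 0 x; exact. Qed.

Lemma near_sqdist x r : 0 < r -> \forall y \near x, sqdist x y < r.
Proof.
move=> r0; have := @sqdist_continuous x x; rewrite /continuous_at sqdistxx.
by move=> /cvgr_lt; exact.
Qed.

Lemma nbhs_sqdist x (N : set X) : nbhs x N ->
  exists2 r, 0 < r & forall y, sqdist x y < r -> N y.
Proof.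
move=> /nbhs_ballP[e /= e0 eN]; exists (e ^+ 2); first exact: exprn_gt0.
move=> y xy; apply: eN; split => // i j; rewrite ord1 -ball_normE /ball_ /=.
rewrite distrC -(ltr_pXn2r (n := 2)) ?nnegrE ?normr_ge0 ?(ltW e0)//.
by rewrite real_normK ?num_real// (le_lt_trans (sqdist_coord x y j)).
Qed.

Lemma sqr_le_norm (a r : R) : a ^+ 2 <= r -> `|a| <= 1 + r.
Proof.
move=> ar; have [a1|a1] := leP 1 `|a|; last first.
  by rewrite (le_trans (ltW a1))// lerDl (le_trans _ ar)// sqr_ge0.
by rewrite -real_normK ?num_real// in ar; nra.
Qed.

Lemma compact_sqdist x r : compact [set y | sqdist x y <= r].
Proof.
pose box i : set R := `[x ord0 i - (1 + r), x ord0 i + (1 + r)]%classic.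
have cB : compact [set y : X | forall i, box i (y ord0 i)].
  by apply: (@rV_compact R n.+1 box) => i; exact: segment_compact.
apply: (subclosed_compact _ cB).
  apply: (@preimage_closed _ _ (sqdist x) [set t | t <= r]); last exact: closed_le.
  by move=> y _; exact: sqdist_continuous.
move=> y xy i; rewrite /box /= in_itv/= -ler_distlC distrC.
exact/sqr_le_norm/(le_trans (sqdist_coord x y i)).
Qed.

(** The points where the notion of supersolution tests touching. *)
Definition touch_region : set X := half_ball R n `|` flat_ball R n.

Lemma sqdist0E x : sqdist 0 x = \sum_i x ord0 i ^+ 2.
Proof. by apply: eq_bigr => i _; rewrite mxE subr0. Qed.

Lemma enorm_lt1 x : (enorm x < 1) = (sqdist 0 x < 1).
Proof. by rewrite /enorm -sqdist0E -{1}(sqrtr1 R) ltr_sqrt. Qed.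

Lemma enorm_eq1 x : enorm x = 1 <-> sqdist 0 x = 1.
Proof.
rewrite /enorm -sqdist0E; split => [s1|->]; last exact: sqrtr1.
by rewrite -(sqr_sqrtr (sqdist_ge0 0 x)) s1 expr1n.
Qed.

Lemma closure_half_ball x : closure (half_ball R n) x ->
  sqdist 0 x <= 1 /\ 0 <= x ord0 ord0.
Proof.
have c1 : closed [set x : X | sqdist 0 x <= 1].
  apply: (@preimage_closed _ _ (sqdist 0) [set t | t <= 1]); last exact: closed_le.
  by move=> y _; exact: sqdist_continuous.
have c2 : closed [set x : X | 0 <= x ord0 ord0].
  apply: (@preimage_closed _ _ (fun x : X => x ord0 ord0) [set t | 0 <= t]).
    by move=> y _; exact: coord_continuous.
  exact: closed_ge.
pose C := [set x : X | sqdist 0 x <= 1] `&` [set x : X | 0 <= x ord0 ord0].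
suff : closure (half_ball R n) `<=` C by apply.
rewrite [X in _ `<=` X](closure_id C).1; last exact: closedI.
apply: closure_subset => y [y1 y0]; split => /=; last exact: ltW.
by rewrite ltW// -enorm_lt1.
Qed.

Lemma touch_regionP x : touch_region x <-> sqdist 0 x < 1 /\ 0 <= x ord0 ord0.
Proof.
rewrite -enorm_lt1; split=> [[] [x1 x0]|[x1]].
- by split => //; exact: ltW.
- by rewrite x0.
- by rewrite le_eqVlt => /predU1P[x0|x0]; [right|left].
Qed.

(** Boundary data live on the half sphere, test functions touch elsewhere. *)
Lemma closure_half_ball_cases x : closure (half_ball R n) x ->
  touch_region x \/ half_sphere R n x.
Proof.
move=> /closure_half_ball[]; rewrite le_eqVlt => /predU1P[x1 x0|x1 x0].
  by right; split => //; apply/enorm_eq1.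
by left; apply/touch_regionP.
Qed.

(** A flat point is the limit of its translates in the direction [x_1]. *)
Lemma touch_region_closure : touch_region `<=` closure (half_ball R n).
Proof.
move=> x /touch_regionP[x1 x0] B Bx.
have [r r0 rN] := nbhs_sqdist (filterI Bx (sqdist_ltI x1)).
pose t := Num.min 1 r / 2.
have [t0 tr t1] : [/\ 0 < t, t < r & t < 1].
  have m0 : 0 < Num.min 1 r by rewrite lt_min ltr01 r0.
  have m1 : Num.min 1 r <= 1 by rewrite ge_min lexx.
  have mr : Num.min 1 r <= r by rewrite ge_min lexx orbT.
  by rewrite /t; split; lra.
have [By y1] : (B `&` [set y | sqdist 0 y < 1]) (t *: delta_mx ord0 ord0 + x).
  apply: rN; rewrite /sqdist (bigD1 ord0)//= big1 => [|i /negbTE i0].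
    by rewrite !mxE !eqxx addrK addr0 mulr1; nra.
  by rewrite !mxE i0 mulr0 add0r subrr expr0n.
exists (t *: delta_mx ord0 ord0 + x); split => //.
by split; rewrite /= ?enorm_lt1// !mxE !eqxx mulr1 ltr_pwDl.
Qed.

Lemma touch_region_nsphere x : touch_region x -> ~ half_sphere R n x.
Proof. by move=> /touch_regionP[x1 _] [/enorm_eq1 x1' _]; move: x1; rewrite x1' ltxx. Qed.

Lemma compact_closure_half_ball : compact (closure (half_ball R n)).
Proof.
have sub : closure (half_ball R n) `<=` [set x | sqdist 0 x <= 1].
  by move=> x /closure_half_ball[].
exact: subclosed_compact (@closed_closure _ _) (@compact_sqdist 0 1) sub.
Qed.

End Geometry.

(** * One-variable derivative tests *)

Section DerivativeTests.
Context {R : realType}.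
Implicit Types (g dg : R -> R) (a c d : R).

Lemma cvg_at_right_dnbhs (T : topologicalType) (F : R -> T) a (l : T) :
  F @ a^' --> l -> F @ a^'+ --> l.
Proof.
apply: cvg_trans => P; rewrite /= !nbhs_filterE /fmap /= /dnbhs /at_right /within /=.
by apply: filterS => x Px ax; apply: Px; rewrite gt_eqF.
Qed.

Lemma is_derive_le_right g d c : is_derive (0 : R) (1 : R) g d ->
  (\forall t \near 0^'+, g t <= g 0 + c * t) -> d <= c.
Proof.
move=> [dg <-] gle.
have cq : h^-1 *: (g (h *: (1 : R) + 0) - g 0) @[h --> 0^'+] --> 'D_1 g 0.
  exact: cvg_at_right_dnbhs dg.
apply: (cvgr_to_le cq); near=> h.
have h0 : 0 < h by near: h; exact: nbhs_right_gt.
rewrite addr0 [h *: 1]mulr1 /GRing.scale/= ler_pdivrMl// lerBlDl mulrC.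
by near: h.
Unshelve. all: by end_near. Qed.

Lemma is_derive_le_near g d c : is_derive (0 : R) (1 : R) g d ->
  (\forall t \near (0 : R), g t <= g 0 + c * t) -> d = c.
Proof.
move=> gd gle; apply/eqP; rewrite eq_le; apply/andP; split.
  by apply: (is_derive_le_right gd); exact: cvg_within.
rewrite -lerN2; apply: (@is_derive_le_right (fun t => g (- t))).
  have gd' : is_derive (- 0 : R) (1 : R) g d by rewrite oppr0.
  by rewrite -mulrN1; apply: (@is_derive1_comp _ g (fun t => - t)); exact: is_deriveNid.
have oc : (fun t : R => - t) @ (0 : R) --> (0 : R).
  by rewrite -{2}oppr0; exact: opp_continuous.
have gle' : \forall t \near (0 : R), g (- t) <= g 0 + c * - t by exact: (oc _ gle).
rewrite oppr0 near_withinE; near=> t => _; rewrite mulNr -mulrN.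
by near: t.
Unshelve. all: by end_near. Qed.

(** Were [d] positive, [dg] would exceed [c] on the right of [0], and so would
    the slope of the chords of [g] by the mean value theorem. *)
Lemma second_derivative_test g dg d c :
  (forall t, is_derive t (1 : R) g (dg t)) ->
  is_derive (0 : R) (1 : R) dg d ->
  (\forall t \near (0 : R), g t <= g 0 + c * t) -> d <= 0.
Proof.
move=> gd dgd gle.
have dg0 : dg 0 = c by exact: is_derive_le_near (gd 0) gle.
rewrite leNgt; apply/negP => d0.
have cq : h^-1 *: (dg (h *: (1 : R) + 0) - dg 0) @[h --> 0^'+] --> d.
  by case: dgd => dgd <-; exact: cvg_at_right_dnbhs dgd.
have : \forall t \near 0^'+, g t <= g 0 + c * t /\ c < dg t.
  near=> h; have h0 : 0 < h by near: h; exact: nbhs_right_gt.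
  split; first by near: h; exact: cvg_within.
  have : 0 < h^-1 *: (dg (h *: (1 : R) + 0) - dg 0).
    by near: h; exact: (cvgr_gt d).
  by rewrite addr0 [h *: 1]mulr1 pmulr_rgt0 ?invr_gt0// dg0 subr_gt0.
move=> /nbhs_ballP[e /= e0 eP].
have h0 : 0 < e / 2 by rewrite divr_gt0.
have eP' t : 0 < t -> t <= e / 2 -> g t <= g 0 + c * t /\ c < dg t.
  by move=> t0 te; apply: eP => //; rewrite /ball/= sub0r normrN gtr0_norm//; lra.
have [|t] := @MVT _ g dg 0 (e / 2) h0 (fun t _ => gd t).
  apply: continuous_subspaceT => t; apply/differentiable_continuous/derivable1_diffP.
  by case: (gd t).
rewrite in_itv/= => /andP[t0 te]; rewrite subr0 => gE.
have [_ ct] := eP' _ t0 (ltW te); have [gh _] := eP' _ h0 (lexx _).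
by move: gh; rewrite -lerBlDl gE ler_pM2r// leNgt ct.
Unshelve. all: by end_near. Qed.

End DerivativeTests.

(** * Touching from below *)

Section Touching.
Context {R : realType} {n : nat}.
Local Notation X := 'rV[R]_n.+1.
Local Notation A := (@touch_region R n).
Local Notation D := (closure (half_ball R n)).
Implicit Types (f : R -> R) (u v q phi : X -> R) (x y z : X) (i : 'I_n.+1).

(** Semicontinuity on the subspace only concerns its own points, the other ones
    being isolated. *)
Lemma lscP u :
  lower_semicontinuous (fun x : subspace D => (u x)%:E) <->
  (forall x a, D x -> a < u x -> \forall y \near x, D y -> a < u y).
Proof.
split=> [lu x a Dx ax|lu x a].
  have [|V xV Va] := lu x a; first by rewrite lte_fin.
  have : within D (nbhs x) V by rewrite nbhs_subspace_in.
  by apply: filterS => y /Va; rewrite lte_fin.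
rewrite lte_fin => ax; exists [set y | a < u y]; last by move=> y; rewrite lte_fin.
change (nbhs_subspace (A := D) x [set y | a < u y]).
have [Dx|nDx] := pselect (D x).
  by rewrite -nbhs_subspace_in//; exact: lu.
by rewrite -nbhs_subspace_out// => y ->.
Qed.

Lemma lsc_sub_continuous u q x a : (forall x a, D x -> a < u x ->
  \forall y \near x, D y -> a < u y) -> continuous q -> D x ->
  a < u x - q x -> \forall y \near x, D y -> a < u y - q y.
Proof.
move=> lu cq Dx ax; pose e := (u x - q x - a) / 2.
have e0 : 0 < e by rewrite divr_gt0// subr_gt0.
near=> y => Dy.
have : u x - e < u y.
  by move: Dy; near: y; apply: lu => //; rewrite ltrBlDr ltrDl.
have : q y < q x + e.
  near: y; have /cvgr_lt := cq x; apply; by rewrite ltrDl.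
by rewrite /e; lra.
Unshelve. all: by end_near. Qed.

(** A strict subsolution at [x]: the two alternatives in the definition of a
    supersolution fail, so such a [q] cannot touch one from below at [x]. *)
Definition strict_at f q x :=
  0 < laplacian q x /\
  (flat_ball R n x -> Lsup f (tangential_gradient q x) < partial ord0 q x).

(** Touching up to an additive constant: this is what minimizing [u - q] over a
    compact set produces. *)
Definition local_min u q z :=
  A z /\ \forall x \near z, A x -> u z - q z <= u x - q x.

Lemma local_min_touches u q z : local_min u q z ->
  touches_below (q + cst (u z - q z)) u z.
Proof.
move=> [_ zmin]; split; first by rewrite !fctE; lra.
rewrite near_withinE; near=> x => Ax.
have : u z - q z <= u x - q x by move: Ax; near: x.
by rewrite !fctE; lra.
Unshelve. all: by end_near. Qed.

Lemma tangential_gradient_add_cst q c : smooth q ->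
  tangential_gradient (q + cst c) = tangential_gradient q.
Proof.
by move=> sq; apply/funext => x; apply/rowP => j; rewrite !mxE partial_add_cst.
Qed.

Lemma local_min_flat f u q z : supersolution f u -> smooth q ->
  local_min u q z -> 0 < laplacian q z ->
  flat_ball R n z /\ partial ord0 q z <= Lsup f (tangential_gradient q z).
Proof.
move=> [_ su] sq zmin L0.
have [|||] := su (q + cst (u z - q z)) z zmin.1.
- by apply: smoothD => //; exact: smooth_cst.
- exact: local_min_touches.
- by rewrite laplacian_add_cst// leNgt L0.
- by rewrite partial_add_cst// tangential_gradient_add_cst.
Qed.

Lemma local_min_not_strict f u q z : supersolution f u -> smooth q ->
  local_min u q z -> ~ strict_at f q z.
Proof.
move=> su sq zmin [L0 fl].
have [/fl] := local_min_flat su sq zmin L0.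
by rewrite ltNge => /negP.
Qed.

(** This is where the discontinuity of [L^*] enters. *)
Lemma Lsup_gt_mean f b (p : 'rV[R]_n) : mean f < b -> b <= Lsup f p -> p = 0.
Proof.
by rewrite /Lsup; case: eqP => // _ fb /le_lt_trans/(_ fb); rewrite ltxx.
Qed.

Lemma min_on_compact f u q (K : set X) : supersolution f u -> continuous q ->
  compact K -> K `<=` D -> K !=set0 ->
  exists2 z, K z & forall x, K x -> u z - q z <= u x - q x.
Proof.
move=> [/lscP lu _] cq cK KD K0.
apply: (@compact_lsc_min _ _ K (fun x => u x - q x)) => // x a Kx ax.
by apply: filterS (lsc_sub_continuous lu cq (KD _ Kx) ax) => y h /KD.
Qed.

(** Otherwise [u - q] would have a negative minimum, attained off the sphere, at
    which [q] would touch [u] up to a constant. *)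
Lemma strict_le_supersolution f u q : supersolution f u -> smooth q ->
  (forall x, A x -> strict_at f q x) ->
  (forall x, half_sphere R n x -> q x <= u x) ->
  forall x, D x -> q x <= u x.
Proof.
move=> su sq sA qs x Dx.
have [||z Dz zmin] := min_on_compact su (smooth_continuous sq)
  (@compact_closure_half_ball R n).
- by [].
- by exists x.
suff : 0 <= u z - q z by have := zmin _ Dx; lra.
have [Az|/qs] := closure_half_ball_cases Dz; last by rewrite subr_ge0.
exfalso; apply: (local_min_not_strict su sq _ (sA _ Az)); split => //.
by near=> y => /touch_region_closure; exact: zmin.
Unshelve. all: by end_near. Qed.

(** The minimum over the part of the closed ball in [A] cannot be attained on the
    sphere [sqdist x z = r], where [u - q] exceeds its value at [y]. *)
Lemma local_min_in_ball f u q x r y : supersolution f u -> smooth q ->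
  (forall z, sqdist x z <= r -> sqdist 0 z < 1) ->
  A y -> sqdist x y <= r ->
  (forall z, A z -> sqdist x z = r -> u y - q y < u z - q z) ->
  exists2 z, local_min u q z & sqdist x z < r.
Proof.
move=> su sq r1 Ay xy bd.
pose K := D `&` [set z | sqdist x z <= r].
have cK : compact K.
  apply: subclosed_compact (@compact_sqdist _ _ x r) _; last by move=> z [].
  apply: closedI; first exact: closed_closure.
  apply: (@preimage_closed _ _ (sqdist x) [set t | t <= r]); last exact: closed_le.
  by move=> z _; exact: sqdist_continuous.
have [||z [Dz xz] zmin] := min_on_compact su (smooth_continuous sq) cK.
- by move=> z [].
- by exists y; split => //; exact: touch_region_closure.
have Az : A z.
  have [//|[/enorm_eq1 z1 _]] := closure_half_ball_cases Dz.
  by have := r1 _ xz; rewrite z1 ltxx.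
have zr : sqdist x z < r.
  rewrite lt_neqAle xz andbT; apply/eqP => zr.
  have := bd _ Az zr; rewrite ltNge zmin//; split => //.
  exact: touch_region_closure.
exists z => //; split => //; near=> t => At; apply: zmin; split.
  exact: touch_region_closure.
apply: ltW; near: t; have /cvgr_lt := @sqdist_continuous _ _ x z; exact.
Unshelve. all: by end_near. Qed.

End Touching.

(** * Second-order Taylor bound *)

Section Taylor.
Context {R : realType} {n : nat}.
Local Notation X := 'rV[R]_n.+1.
Implicit Types (phi : X -> R) (x y z : X) (i j : 'I_n.+1).

Lemma mean_value (g dg : R -> R) (h : R) :
  (forall t, is_derive t (1 : R) g (dg t)) ->
  exists2 t, `|t| <= `|h| & g h - g 0 = dg t * h.
Proof.
move=> gd; have cg : continuous g.
  move=> t; apply/differentiable_continuous/derivable1_diffP.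
  by case: (gd t).
have [h0|h0] := leP 0 h.
  have [t] := MVT_segment h0 (fun t _ => gd t) (continuous_subspaceT cg).
  rewrite in_itv/= subr0 => /andP[t0 th] gE; exists t => //.
  by rewrite !ger0_norm.
have [t] := MVT_segment (ltW h0) (fun t _ => gd t) (continuous_subspaceT cg).
rewrite in_itv/= sub0r => /andP[ht t0] gE; exists t.
  by rewrite !ler0_norm ?lerN2// ltW.
by rewrite -opprB gE mulrN opprK.
Qed.

Definition closer x y z := forall j,
  `|z ord0 j - x ord0 j| <= `|y ord0 j - x ord0 j|.

Lemma closer_sqdist x y z : closer x y z -> sqdist x z <= sqdist x y.
Proof.
move=> xyz; apply: ler_sum => j _.
by rewrite -[leLHS]real_normK ?num_real// -[leRHS]real_normK ?num_real// lerXn2r.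
Qed.

(** Moving from [x] to [y] one coordinate at a time reduces the mean value
    theorem to one variable. *)
Lemma coordinate_mean_value phi x y : smooth phi ->
  exists2 xi : 'I_n.+1 -> X, forall i, closer x y (xi i) &
    phi y - phi x = \sum_i partial i phi (xi i) * (y ord0 i - x ord0 i).
Proof.
move=> sphi; pose z k : X := \row_i if (i < k)%N then y ord0 i else x ord0 i.
have step i : exists xi, closer x y xi /\
    phi (z i.+1) - phi (z i) = partial i phi xi * (y ord0 i - x ord0 i).
  have [t th gE] := @mean_value (fun t => phi (t *: delta_mx ord0 i + z i))
    (fun t => partial i phi (t *: delta_mx ord0 i + z i))
    (y ord0 i - x ord0 i)
    (fun t => (is_derive_line _ _ _ _ _).1
       (derivableP (@smooth_derivable _ _ phi i _ sphi))).
  exists (t *: delta_mx ord0 i + z i); split.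
    move=> j; rewrite !mxE eqxx /=; have [->|ji] := eqVneq j i.
      by rewrite ltnn mulr1 addrK.
    by rewrite mulr0 add0r; case: ifP => // _; rewrite subrr normr0.
  rewrite -gE; congr (phi _ - phi _); apply/rowP => j; rewrite !mxE eqxx /=.
    have [->|ji] := eqVneq j i; first by rewrite ltnn leqnn mulr1 subrK.
    by rewrite mulr0 add0r ltnS leq_eqVlt (negbTE (ji : val j != val i)).
  by rewrite mul0r add0r.
have [xi xiP] := choice step; exists xi; first by move=> i; case: (xiP i).
rewrite -(eq_bigr _ (fun i _ => (xiP i).2)).
rewrite -(big_mkord xpredT (fun k => phi (z k.+1) - phi (z k))).
rewrite telescope_sumr//; congr (phi _ - phi _); apply/rowP => j; rewrite mxE//.
by rewrite ltn_ord.
Qed.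

Lemma le_double_sum (m : 'I_n.+1 -> 'I_n.+1 -> R) i j :
  (forall i j, 0 <= m i j) -> m i j <= \sum_i \sum_j m i j.
Proof.
move=> m0; apply: (@le_trans _ _ (\sum_j m i j)).
  by rewrite (bigD1 j)//= lerDl sumr_ge0.
rewrite [leRHS](bigD1 i)//= lerDl; apply: sumr_ge0 => k _.
exact: sumr_ge0.
Qed.

Lemma near_partial2_bounded phi x : smooth phi ->
  exists B, 0 <= B /\
    \forall y \near x, forall i j, `|partial j (partial i phi) y| <= B.
Proof.
move=> sphi.
pose m i j := `|partial j (partial i phi) x| + 1.
have m0 i j : 0 <= m i j by rewrite addr_ge0.
exists (\sum_i \sum_j m i j); split.
  by apply: sumr_ge0 => i _; apply: sumr_ge0 => j _.
pose bnd i j y := `|partial j (partial i phi) y| <= \sum_i \sum_j m i j.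
apply: (@filter_forall X 'I_n.+1 (fun i y => forall j, bnd i j y) (nbhs x) _) => i.
apply: (@filter_forall X 'I_n.+1 (bnd i) (nbhs x) _) => j.
have c : continuous (partial j (partial i phi)).
  by apply: smooth_continuous; do 2!apply: smooth_partial.
have : \forall y \near x, `|partial j (partial i phi) x - partial j (partial i phi) y| < 1.
  by have /cvgrPdist_lt := c x; apply.
apply: filterS => y; rewrite distrC => /ltW h.
apply: (@le_trans _ _ (m i j)).
  rewrite /m addrC -lerBlDr; apply: le_trans h.
  exact: lerB_dist.
exact: le_double_sum.
Qed.

(** The mean value theorem is applied to [phi], then to its partial derivatives,
    whose own derivatives are bounded near [x]. *)
Lemma taylor_lower phi x : smooth phi ->
  exists C : R, 0 <= C /\ \forall y \near x,
    phi x - C * sqdist x y + \sum_i partial i phi x * (y ord0 i - x ord0 i)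
    <= phi y.
Proof.
move=> sphi; have [B [B0 Bx]] := near_partial2_bounded x sphi.
have [r r0 rB] := nbhs_sqdist Bx.
exists (\sum_(i < n.+1) \sum_(j < n.+1) B); split.
  by apply: sumr_ge0 => i _; apply: sumr_ge0.
apply: filterS (near_sqdist x r0) => y yr.
have [xi xiy ->] : exists2 xi : 'I_n.+1 -> X, forall i, closer x y (xi i) &
    phi y = phi x + \sum_i partial i phi (xi i) * (y ord0 i - x ord0 i).
  have [xi xiy xiE] := coordinate_mean_value x y sphi.
  by exists xi => //; rewrite -xiE addrC subrK.
have coordM (a b S : R) : a ^+ 2 <= S -> b ^+ 2 <= S -> a * b <= S.
  by move=> aS bS; have := sqr_ge0 (a - b); rewrite sqrrB; lra.
have : `|\sum_i (partial i phi (xi i) - partial i phi x) *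
    (y ord0 i - x ord0 i)| <= (\sum_(i < n.+1) \sum_(j < n.+1) B) * sqdist x y.
  rewrite mulr_suml; apply: le_trans (ler_norm_sum _ _ _) _.
  apply: ler_sum => i _.
  have [zeta zetac ->] := coordinate_mean_value x (xi i) (smooth_partial i sphi).
  rewrite !mulr_suml; apply: le_trans (ler_norm_sum _ _ _) _.
  apply: ler_sum => j _; rewrite -mulrA normrM; apply: ler_pM => //.
    apply: rB; apply: le_lt_trans (closer_sqdist (zetac j)) _.
    exact: le_lt_trans (closer_sqdist (xiy i)) yr.
  rewrite normrM; apply: (@le_trans _ _ (`|y ord0 j - x ord0 j| * `|y ord0 i - x ord0 i|)).
    by apply: ler_wpM2r => //; exact: xiy.
  by apply: coordM; rewrite real_normK ?num_real// sqdist_coord.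
rewrite ler_norml => /andP[+ _].
have -> : \sum_i (partial i phi (xi i) - partial i phi x) * (y ord0 i - x ord0 i) =
    \sum_i partial i phi (xi i) * (y ord0 i - x ord0 i) -
    \sum_i partial i phi x * (y ord0 i - x ord0 i).
  by rewrite -sumrB; apply: eq_bigr => i _; rewrite mulrBl.
lra.
Qed.

End Taylor.

(** * The contact set of a supersolution is open *)

Section ContactSet.
Context {R : realType} {n : nat}.
Local Notation X := 'rV[R]_n.+1.
Local Notation A := (@touch_region R n).
Implicit Types (f : R -> R) (u phi : X -> R) (x y z : X).
Implicit Types (b K L : R) (p : 'rV[R]_n).

(** The test function [b x_1 + K x_1^2 + p . (x - y)' - L |(x - y)'|^2]. *)
Definition paraboloid b K L p y : X -> R := dquad
  (- \sum_j (p ord0 j * y ord0 (lift ord0 j) + L * y ord0 (lift ord0 j) ^+ 2))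
  (fun i => if unlift ord0 i is Some j then p ord0 j + 2 * L * y ord0 i else b)
  (fun i => if unlift ord0 i is Some j then - L else K).

Lemma paraboloidE b K L p y x : paraboloid b K L p y x =
  b * x ord0 ord0 + K * x ord0 ord0 ^+ 2 +
  \sum_j (p ord0 j * (x ord0 (lift ord0 j) - y ord0 (lift ord0 j)) -
          L * (x ord0 (lift ord0 j) - y ord0 (lift ord0 j)) ^+ 2).
Proof.
rewrite /paraboloid /dquad big_ord_recl unlift_none addrCA; congr (_ + _).
rewrite -sumrN -big_split/=; apply: eq_bigr => j _; rewrite liftK; ring.
Qed.

Lemma paraboloid0E b K L y x : paraboloid b K L 0 y x =
  b * x ord0 ord0 + K * x ord0 ord0 ^+ 2 -
  L * \sum_j (x ord0 (lift ord0 j) - y ord0 (lift ord0 j)) ^+ 2.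
Proof.
rewrite paraboloidE; congr (_ + _); rewrite mulr_sumr -sumrN.
by apply: eq_bigr => j _; rewrite mxE mul0r sub0r.
Qed.

Lemma smooth_paraboloid b K L p y : smooth (paraboloid b K L p y).
Proof. exact: smooth_dquad. Qed.

Lemma partial0_paraboloid b K L p y x :
  partial ord0 (paraboloid b K L p y) x = b + 2 * K * x ord0 ord0.
Proof. by rewrite partial_dquadE unlift_none. Qed.

Lemma tangential_gradient_paraboloid b K L p y x :
  tangential_gradient (paraboloid b K L p y) x =
  p - \row_j (2 * L * (x ord0 (lift ord0 j) - y ord0 (lift ord0 j))).
Proof.
by apply/rowP => j; rewrite !mxE partial_dquadE liftK; ring.
Qed.

Lemma laplacian_paraboloid b K L p y x :
  laplacian (paraboloid b K L p y) x = 2 * (K - L *+ n).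
Proof.
rewrite laplacian_dquad big_ord_recl unlift_none; congr (2 * (_ + _)).
rewrite (eq_bigr (fun=> - L)) => [|j _]; last by rewrite liftK.
by rewrite sumr_const card_ord mulNrn.
Qed.

Lemma sqdist_recl x y : sqdist x y = (y ord0 ord0 - x ord0 ord0) ^+ 2 +
  \sum_j (y ord0 (lift ord0 j) - x ord0 (lift ord0 j)) ^+ 2.
Proof. exact: big_ord_recl. Qed.

(** Since [L^* = <f>] off [p = 0], a slope larger than [<f>] at a contact point
    forces the tangential gradient to vanish there; then a paraboloid of
    vertex [x], concave in [x'], touches with a quadratic margin. *)
Lemma contact_paraboloid f u x : supersolution f u -> contact_set f u x ->
  exists b K L, [/\ mean f < b, 0 < L, 0 < K - L *+ n &
    \forall y \near x, A y -> u x + sqdist x y <= u y - paraboloid b K L 0 x y].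
Proof.
move=> su [fx [phi [sphi [ux tphi] fphi]]].
have x0 : x ord0 ord0 = 0 by case: fx.
set b0 := partial ord0 phi x in fphi.
have [C [C0 tay]] := taylor_lower x sphi.
(* Near [x] the loss of slope [(b0 - b) x_1] dominates any multiple of [x_1^2],
   so [K] is free; this value makes the Laplacian positive. *)
pose b := (mean f + b0) / 2; pose L := C + 1; pose K := L *+ n + 1.
pose p := tangential_gradient phi x.
have fb : mean f < b by rewrite /b; lra.
have L0 : 0 < L by rewrite /L; lra.
have KL : 0 < K - L *+ n by rewrite /K; lra.
have K0 : 0 <= K by rewrite /K addr_ge0// mulrn_wge0// ltW.
have bd : \forall y \near x,
    A y -> u x + sqdist x y <= u y - paraboloid b K L p x y.
  have cx : (fun y : X => y ord0 ord0) @ x --> (0 : R).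
    by rewrite -x0; exact: coord_continuous.
  have e0 : 0 < (b0 - b) / (C + 1 + K) by rewrite divr_gt0 /b; lra.
  near=> y => Ay.
  have y0 : 0 <= y ord0 ord0 by have /touch_regionP[] := Ay.
  have uy : phi y <= u y by move: Ay; near: y; rewrite near_withinE in tphi.
  have ty : phi x - C * sqdist x y +
      \sum_i partial i phi x * (y ord0 i - x ord0 i) <= phi y by near: y.
  have ye : y ord0 ord0 < (b0 - b) / (C + 1 + K).
    by near: y; have /cvgr_lt := cx; apply.
  rewrite ltr_pdivlMr in ye; last by lra.
  rewrite ux paraboloidE; move: ty; rewrite sqdist_recl big_ord_recl x0 !subr0.
  rewrite sumrB -mulr_sumr -/b0.
  set T := \sum_(j < n) _ ^+ 2.
  rewrite [X in _ + (_ + X) <= _ -> _](_ : _ = \sum_j p ord0 j *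
    (y ord0 (lift ord0 j) - x ord0 (lift ord0 j))); last first.
    by apply: eq_bigr => j _; rewrite mxE.
  set P := \sum_(j < n) _.
  have : y ord0 ord0 * (y ord0 ord0 * (C + 1 + K)) <= y ord0 ord0 * (b0 - b).
    by apply: ler_wpM2l => //; exact: ltW.
  rewrite /L; lra.
suff p0 : p = 0 by exists b, K, L; split => //; rewrite -p0.
have par0 : paraboloid b K L p x x = 0.
  rewrite paraboloidE x0 big1 => [|j _]; last by rewrite subrr expr0n !mulr0 subr0.
  by rewrite expr0n !mulr0 !addr0.
have lm : local_min u (paraboloid b K L p x) x.
  split; first by right.
  apply: filterS bd => y yx /yx; rewrite par0 subr0.
  by have := sqdist_ge0 x y; lra.
have [] := local_min_flat su (smooth_paraboloid _ _ _ _ _) lm.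
  by rewrite laplacian_paraboloid mulr_gt0.
rewrite partial0_paraboloid x0 mulr0 addr0 => _ /(Lsup_gt_mean fb).
rewrite tangential_gradient_paraboloid => /eqP; rewrite subr_eq0 => /eqP ->.
by apply/rowP => j; rewrite !mxE subrr mulr0.
Unshelve. all: by end_near. Qed.

(** The minimum of [u] minus the paraboloid of vertex [y] near [x] can only be
    attained where the paraboloid is horizontal along the boundary, that is, at
    [y]: every flat point [y] close to [x] is a contact point. *)
Lemma contact_near f u x : supersolution f u -> contact_set f u x ->
  \forall y \near x, flat_ball R n y -> contact_set f u y.
Proof.
move=> su cx; have [fx _] := cx.
have [b [K [L [fb L0 KL par]]]] := contact_paraboloid su cx.
have x0 : x ord0 ord0 = 0 by case: fx.
have x1 : sqdist 0 x < 1 by rewrite -enorm_lt1; case: fx.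
have N1 := sqdist_ltI x1.
have [s s0 sN] := nbhs_sqdist (filterI par N1).
pose r := s / 2.
have r0 : 0 < r by rewrite divr_gt0.
have rs y : sqdist x y <= r -> sqdist x y < s by rewrite /r; lra.
(* On the sphere [sqdist x z = r], moving the vertex from [x] to [y] raises the
   paraboloid, normalized at [x], by at most [r / 2 + 2 L^2 sqdist x y]: this
   has to be less than the margin [r] left by [par]. *)
have rho0 : 0 < r / (4 * L ^+ 2 + 1).
  by rewrite divr_gt0// ltr_wpDl// mulr_ge0// sqr_ge0.
apply: filterS (near_sqdist x rho0) => y xy fy.
have y0 : y ord0 ord0 = 0 by case: fy.
pose q := paraboloid b K L 0 y.
have sq : smooth q by exact: smooth_paraboloid.
have [||||z zmin zr] := @local_min_in_ball _ _ f u q x r x su sq.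
- by move=> z /rs/sN[].
- by right.
- by rewrite sqdistxx ltW.
- move=> z Az zr; have zle : sqdist x z <= r by rewrite zr.
  have [zs _] := sN _ (rs _ zle).
  pose F (w : X) (j : 'I_n) : R := w ord0 (lift ord0 j).
  have Tle (w w' : X) : \sum_j (F w' j - F w j) ^+ 2 <= sqdist w w'.
    by rewrite sqdist_recl lerDr sqr_ge0.
  have young : \sum_j (- L * (F z j - F y j) ^+ 2 + L * (F x j - F y j) ^+ 2 +
        L * (F z j - F x j) ^+ 2) <=
      \sum_j (2^-1 * (F z j - F x j) ^+ 2 + 2 * L ^+ 2 * (F y j - F x j) ^+ 2).
    apply: ler_sum => j _.
    by have := sqr_ge0 (F z j - F x j - 2 * L * (F y j - F x j)); nra.
  move: young; rewrite !big_split -!mulr_sumr/=.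
  have xy' : sqdist x y * (4 * L ^+ 2 + 1) < r.
    by rewrite -ltr_pdivlMr// ltr_wpDl// mulr_ge0// sqr_ge0.
  have Lxy : L ^+ 2 * \sum_j (F y j - F x j) ^+ 2 <= L ^+ 2 * sqdist x y.
    by apply: ler_wpM2l; [exact: sqr_ge0|exact: Tle].
  have := Tle x z; have := sqdist_ge0 x y.
  have := zs Az; rewrite zr /q !paraboloid0E x0 expr0n !mulr0 !addr0 !add0r.
  rewrite -!/(F _ _); lra.
have [|fz] := local_min_flat su sq zmin.
  by rewrite laplacian_paraboloid mulr_gt0.
have z0 : z ord0 ord0 = 0 by case: fz.
rewrite partial0_paraboloid z0 mulr0 addr0 => /(Lsup_gt_mean fb).
rewrite tangential_gradient_paraboloid sub0r => /eqP; rewrite oppr_eq0 => /eqP zy.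
have {}zy : z = y.
  apply/rowP => i; case: (unliftP ord0 i) => [j ->|->]; last by rewrite z0 y0.
  move/rowP: zy => /(_ j); rewrite !mxE => /eqP.
  by rewrite !mulf_eq0 (gt_eqF L0) pnatr_eq0/= subr_eq0 => /eqP.
rewrite zy in zmin; split => //; exists (q + cst (u y - q y)); split.
- by apply: smoothD => //; exact: smooth_cst.
- exact: local_min_touches.
- by rewrite partial_add_cst// partial0_paraboloid y0 mulr0 addr0.
Qed.

Lemma contact_set_open f u : supersolution f u ->
  open (contact_set f u : set (subspace (flat_ball R n))).
Proof.
move=> su; rewrite openE => x cx; have [fx _] := cx.
change (nbhs_subspace (A := flat_ball R n) x (contact_set f u)).
by rewrite -nbhs_subspace_in//; exact: contact_near.
Qed.

End ContactSet.

(** * Functions of maximal slope *)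

Section Saturated.
Context {R : realType} {n : nat}.
Local Notation X := 'rV[R]_n.+1.
Local Notation A := (@touch_region R n).
Local Notation S := (half_sphere R n).
Local Notation D := (closure (half_ball R n)).
Implicit Types (f : R -> R) (g u v q phi : X -> R) (x y z : X) (c : R).

(** With slope [max f] and no tangential gradient, this function attains the
    upper bound on the slope everywhere on the flat boundary. *)
Definition saturated f c : X -> R := fun x => sup (range f) * x ord0 ord0 + c.

Lemma saturated_line f c x t i :
  saturated f c (t *: delta_mx ord0 i + x) =
  saturated f c x + sup (range f) *+ (i == ord0) * t.
Proof.
rewrite /saturated !mxE eqxx/=; case: eqVneq => _; rewrite ?mulr1n ?mulr0n; ring.
Qed.

Lemma near_line x i (P : set X) : nbhs x P ->
  \forall t \near (0 : R), P (t *: delta_mx ord0 i + x).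
Proof.
have : (fun t : R => t *: delta_mx ord0 i + x : X) @ (0 : R) --> x.
  rewrite -{2}[x]add0r -(scale0r (delta_mx ord0 i)).
  apply: cvgD; last exact: cvg_cst.
  by apply: cvgZr_tmp; exact: cvg_id.
exact.
Qed.

(** Along a coordinate line that stays in the region, touching a function
    affine on that line from below gives the one-variable conditions. *)
Lemma touch_line f c phi x i : smooth phi -> touches_below phi (saturated f c) x ->
  (\forall t \near (0 : R), A (t *: delta_mx ord0 i + x)) ->
  partial i phi x = sup (range f) *+ (i == ord0) /\
  partial i (partial i phi) x <= 0.
Proof.
move=> sphi [e tphi] tA.
have d (psi : X -> R) t : smooth psi ->
    is_derive t (1 : R) (fun s : R => psi (s *: delta_mx ord0 i + x))
      (partial i psi (t *: delta_mx ord0 i + x)).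
  move=> spsi; apply/is_derive_line/derivableP.
  exact: (@smooth_derivable _ _ psi i _ spsi).
have le : \forall t \near (0 : R), phi (t *: delta_mx ord0 i + x) <=
    phi (0 *: delta_mx ord0 i + x) + sup (range f) *+ (i == ord0) * t.
  rewrite near_withinE in tphi.
  have tl := near_line i tphi; near=> t.
  rewrite scale0r add0r -e -saturated_line.
  have At : A (t *: delta_mx ord0 i + x) by near: t.
  by move: At; near: t.
have d0 := d phi 0 sphi; have := is_derive_le_near d0 le.
rewrite scale0r add0r => ->; split => //.
have := second_derivative_test (fun t => d phi t sphi)
  (d _ 0 (smooth_partial i sphi)) le.
by rewrite scale0r add0r.
Unshelve. all: by end_near. Qed.

Lemma touch_region_tangential x j : A x ->
  \forall t \near (0 : R), A (t *: delta_mx ord0 (lift ord0 j) + x).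
Proof.
move=> /touch_regionP[x1 x0].
have N1 := sqdist_ltI x1.
apply: filterS (near_line (lift ord0 j) N1) => t t1.
by apply/touch_regionP; split => //; rewrite !mxE/= mulr0 add0r.
Qed.

Lemma touch_region_normal x : half_ball R n x ->
  \forall t \near (0 : R), A (t *: delta_mx ord0 ord0 + x).
Proof.
move=> [x1 x0]; rewrite enorm_lt1 in x1.
have N1 := sqdist_ltI x1.
have N2 : \forall y \near x, 0 < (y : X) ord0 ord0.
  by have /cvgr_gt := @coord_continuous R 1 n.+1 ord0 ord0 x; apply.
apply: filterS (near_line ord0 (filterI N1 N2)) => t [t1 /ltW t0].
exact/touch_regionP.
Qed.

(** At interior points the second derivatives are nonpositive in all directions;
    at flat points the tangential gradient vanishes, where the bound on the
    slope is [max f]. *)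
Lemma touch_saturated f c phi x : A x -> smooth phi ->
  touches_below phi (saturated f c) x ->
  laplacian phi x <= 0 \/
  (flat_ball R n x /\ partial ord0 phi x <= Lsup f (tangential_gradient phi x)).
Proof.
move=> Ax sphi tphi.
have tang j := touch_line sphi tphi (touch_region_tangential j Ax).
have [hx|fx] := Ax.
  left; apply: sumr_le0 => i _; case: (unliftP ord0 i) => [j ->|->].
    by have [] := tang j.
  by have [] := touch_line sphi tphi (touch_region_normal hx).
right; split => //.
have -> : tangential_gradient phi x = 0.
  by apply/rowP => j; rewrite !mxE; have [] := tang j.
rewrite /Lsup eqxx.
have [e te] := tphi.
have d0 := (is_derive_line phi (delta_mx ord0 ord0) x 0 (partial ord0 phi x)).1.
apply: (is_derive_le_right (d0 _)).
  rewrite scale0r add0r; apply/derivableP.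
  exact: (@smooth_derivable _ _ phi ord0 _ sphi).
rewrite near_withinE in te.
have x1 : sqdist 0 x < 1 by have /touch_regionP[] := Ax.
have x0 : x ord0 ord0 = 0 by case: fx.
have N1 := sqdist_ltI x1.
rewrite near_withinE.
apply: filterS (near_line ord0 (filterI N1 te)) => t [t1 tl] t0.
rewrite scale0r add0r -e.
rewrite -[X in _ + X * t]mulr1n -[X in _ *+ X](congr1 nat_of_bool (eqxx (ord0 : 'I_n.+1))).
rewrite -saturated_line; apply: tl; apply/touch_regionP; split => //.
by rewrite !mxE !eqxx mulr1 x0 addr0 ltW.
Qed.

End Saturated.

(** * Competitors prescribed on the half sphere *)

Section Competitors.
Context {R : realType} {n : nat}.
Local Notation X := 'rV[R]_n.+1.
Local Notation A := (@touch_region R n).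
Local Notation S := (half_sphere R n).
Local Notation D := (closure (half_ball R n)).
Implicit Types (f : R -> R) (g u v q phi : X -> R) (x y z : X) (c : R).

Lemma within_sphere g x a : {within S, continuous g} -> S x -> a < g x ->
  \forall y \near x, S y -> a < g y.
Proof.
move=> /subspace_continuousP cg Sx ax.
have /cvgr_gt := cg x Sx; move=> /(_ a ax).
by rewrite near_withinE.
Qed.

Lemma within_sphere_lt g x a : {within S, continuous g} -> S x -> g x < a ->
  \forall y \near x, S y -> g y < a.
Proof.
move=> /subspace_continuousP cg Sx ax.
have /cvgr_lt := cg x Sx; move=> /(_ a ax).
by rewrite near_withinE.
Qed.

Definition patch_sphere v g x : R := if `[< A x >] then v x else g x.

Lemma patch_sphere_in v g x : A x -> patch_sphere v g x = v x.
Proof. by move=> Ax; rewrite /patch_sphere asboolT. Qed.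

Lemma patch_sphere_out v g x : S x -> patch_sphere v g x = g x.
Proof.
move=> Sx; rewrite /patch_sphere asboolF// => Ax.
exact: touch_region_nsphere Ax Sx.
Qed.

Lemma near_ball x : A x -> \forall y \near x, sqdist 0 y < 1.
Proof. by move=> /touch_regionP[x1 _]; exact: sqdist_ltI. Qed.

(** Only the lower limits of [v] at the half sphere matter: they have to
    dominate the data. *)
Lemma patch_supersolution f v g : {within S, continuous g} ->
  (forall x a, A x -> a < v x -> \forall y \near x, A y -> a < v y) ->
  (forall x a, S x -> a < g x -> \forall y \near x, A y -> a < v y) ->
  (forall phi x, A x -> smooth phi -> touches_below phi v x ->
    laplacian phi x <= 0 \/
    (flat_ball R n x /\ partial ord0 phi x <= Lsup f (tangential_gradient phi x))) ->
  supersolution f (patch_sphere v g).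
Proof.
move=> cg lA lS tv; split.
  apply/lscP => x a /closure_half_ball_cases[Ax|Sx].
    rewrite patch_sphere_in// => ax.
    have N1 := near_ball Ax; have lAx := lA _ _ Ax ax; near=> y.
    move=> /closure_half_ball_cases[Ay|[/enorm_eq1 y1 _]].
      by rewrite patch_sphere_in//; move: Ay; near: y.
    suff : sqdist 0 y < 1 by rewrite y1 ltxx.
    by near: y.
  rewrite patch_sphere_out// => ax.
  have lSx := lS _ _ Sx ax; have gx := within_sphere cg Sx ax; near=> y.
  move=> /closure_half_ball_cases[Ay|Sy].
    by rewrite patch_sphere_in//; move: Ay; near: y.
  by rewrite patch_sphere_out//; move: Sy; near: y.
move=> phi x Ax sphi [e te]; apply: tv => //; split.
  by rewrite -e patch_sphere_in.
rewrite near_withinE in te; rewrite near_withinE; near=> y => Ay.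
rewrite -(patch_sphere_in v g Ay); by move: Ay; near: y.
Unshelve. all: by end_near. Qed.

Lemma saturated_continuous f c : continuous (saturated f c : X -> R).
Proof.
move=> x; have cx : (fun z : X => z ord0 ord0) @ x --> x ord0 ord0.
  exact: coord_continuous.
exact: cvgD (cvgM (cvg_cst (sup (range f))) cx) (cvg_cst c).
Qed.

Lemma saturated_competitor f g c : {within S, continuous g} ->
  (forall x, S x -> g x <= saturated f c x) ->
  supersolutions_above f g (patch_sphere (saturated f c) g).
Proof.
move=> cg gs; split; last by move=> x Sx; rewrite patch_sphere_out.
apply: patch_supersolution => //.
- move=> x a Ax ax; have := @saturated_continuous f c x.
  by move=> /cvgr_gt/(_ _ ax); apply: filterS.
- move=> x a Sx ax; have := @saturated_continuous f c x.
  by move=> /cvgr_gt/(_ _ (lt_le_trans ax (gs _ Sx))); apply: filterS.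
- move=> phi x; exact: touch_saturated.
Qed.

Lemma compact_half_sphere : compact S.
Proof.
have sub : S `<=` [set x | sqdist 0 x <= 1] by move=> x [/enorm_eq1 x1 _]; rewrite /= x1.
apply: subclosed_compact _ (@compact_sqdist _ _ 0 1) sub.
rewrite (_ : S = [set x | sqdist 0 x = 1] `&` [set x : X | 0 <= x ord0 ord0]).
  apply: closedI.
    apply: (@preimage_closed _ _ (sqdist 0) [set t | t = 1]); last exact: closed_eq.
    by move=> y _; exact: sqdist_continuous.
  apply: (@preimage_closed _ _ (fun x : X => x ord0 ord0) [set t | 0 <= t]).
    by move=> y _; exact: coord_continuous.
  exact: closed_ge.
by apply/seteqP; split => x [x1 x0]; split => //; exact/enorm_eq1.
Qed.

Lemma half_sphere_pole : S (delta_mx ord0 ord0).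
Proof.
split; last by rewrite mxE eqxx.
apply/enorm_eq1; rewrite sqdist0E (bigD1 ord0)//= big1 => [|i /negbTE i0].
  by rewrite mxE !eqxx expr1n addr0.
by rewrite mxE i0 expr0n.
Qed.

Lemma data_min g : {within S, continuous g} ->
  exists2 x, S x & forall y, S y -> g x <= g y.
Proof.
move=> cg; apply: compact_lsc_min compact_half_sphere _ _.
  by exists (delta_mx ord0 ord0); exact: half_sphere_pole.
by move=> x a; exact: within_sphere.
Qed.

Lemma data_max g : {within S, continuous g} ->
  exists2 x, S x & forall y, S y -> g y <= g x.
Proof.
move=> cg; have [||x Sx xmin] := compact_lsc_min (h := fun x => - g x) compact_half_sphere.
- by exists (delta_mx ord0 ord0); exact: half_sphere_pole.
- move=> x a Sx; rewrite ltrNr => gx.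
  by have := within_sphere_lt cg Sx gx; apply: filterS => y h /h; rewrite ltrNr.
- by exists x => // y Sy; rewrite -lerN2; exact: xmin.
Qed.

Lemma sphere_coord0 x : S x -> 0 <= x ord0 ord0 <= 1.
Proof.
move=> [/enorm_eq1 x1 x0]; rewrite x0/=.
have := sqdist_coord 0 x ord0; rewrite x1 mxE subr0 => h.
by rewrite -(@ler_pXn2r _ 2)// ?nnegrE// expr1n.
Qed.

Lemma exists_competitor f g : {within S, continuous g} ->
  supersolutions_above f g !=set0.
Proof.
move=> cg; have [z Sz zmax] := data_max cg.
exists (patch_sphere (saturated f (g z + `|sup (range f)|)) g).
apply: saturated_competitor => // x Sx; apply: le_trans (zmax _ Sx) _.
have /andP[x0 x1] := sphere_coord0 Sx.
have := ler_norm (- sup (range f)); rewrite normrN /saturated.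
have := normr_ge0 (sup (range f)); nra.
Qed.

End Competitors.

(** * Lower barriers *)

Section LowerBarriers.
Context {R : realType} {n : nat}.
Local Notation X := 'rV[R]_n.+1.
Local Notation A := (@touch_region R n).
Local Notation S := (half_sphere R n).
Local Notation D := (closure (half_ball R n)).
Implicit Types (f : R -> R) (g u v q phi : X -> R) (x y z : X) (c : R).

Lemma Lsup_bounded f (p : 'rV[R]_n) :
  Lsup f p < `|sup (range f)| + `|mean f| + 1.
Proof.
have := ler_norm (sup (range f)); have := ler_norm (mean f).
have := normr_ge0 (sup (range f)); have := normr_ge0 (mean f).
by rewrite /Lsup; case: ifP => _; lra.
Qed.

(** [k x0 . x] is largest on the sphere at [x0]; it is nondecreasing in [x_1]
    because [x0] is in the half space, so it does not spoil the slope [m]. *)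
Definition sphere_barrier c (k m : R) x0 : X -> R := dquad c
  (fun i => k * x0 ord0 i + m *+ (i == ord0)) (fun i => (i == ord0)%:R).

Lemma sphere_barrierE c k m x0 x : S x0 -> S x ->
  sphere_barrier c k m x0 x =
  c + k + m * x ord0 ord0 + x ord0 ord0 ^+ 2 - k / 2 * sqdist x0 x.
Proof.
move=> [/enorm_eq1 + _] [/enorm_eq1 + _]; rewrite !sqdist0E => x01 x1.
have -> : sqdist x0 x = 2 - 2 * \sum_i x0 ord0 i * x ord0 i.
  rewrite mulr_sumr -[X in X - _](_ : \sum_i x0 ord0 i ^+ 2 + \sum_i x ord0 i ^+ 2 = 2).
    by rewrite -big_split -sumrB; apply: eq_bigr => i _ /=; ring.
  by rewrite x01 x1.
rewrite /sphere_barrier /dquad.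
have -> : \sum_i ((k * x0 ord0 i + m *+ (i == ord0)) * x ord0 i +
    (i == ord0)%:R * x ord0 i ^+ 2) = k * (\sum_i x0 ord0 i * x ord0 i) +
    (m * x ord0 ord0 + x ord0 ord0 ^+ 2).
  rewrite (bigD1 ord0)//= mulr1n mul1r mulr_sumr [in RHS](bigD1 ord0)//=.
  rewrite (eq_bigr (fun i => k * (x0 ord0 i * x ord0 i))); first ring.
  by move=> i /negbTE ->; rewrite mulr0n mul0r !addr0 mulrA.
by field.
Qed.

Lemma sphere_barrier_strict f c k x0 : 0 <= k -> S x0 ->
  forall x, strict_at f
    (sphere_barrier c k (`|sup (range f)| + `|mean f| + 1) x0) x.
Proof.
move=> k0 [_ x00] x; split.
  rewrite laplacian_dquad (bigD1 ord0)//= big1 => [|i /negbTE ->//].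
  by rewrite addr0 mulr1.
move=> [_ fx]; rewrite partial_dquadE eqxx fx mulr0 addr0.
by apply: lt_le_trans (Lsup_bounded f _) _; rewrite lerDr mulr_ge0.
Qed.

(** The strict convexity of the ball separates [x0] from the rest of the sphere
    by a hyperplane, including when [x0] lies on the equator. *)
Lemma lower_barrier f g x0 a : {within S, continuous g} -> S x0 -> a < g x0 ->
  exists psi, [/\ smooth psi, forall x, strict_at f psi x,
    forall x, S x -> psi x <= g x & psi x0 = a].
Proof.
move=> cg Sx0 ax0; set m := `|sup (range f)| + `|mean f| + 1.
have m0 : 0 < m by rewrite /m ltr_wpDl// addr_ge0.
have [z Sz zmin] := data_min cg.
pose e := (g x0 - a) / 2.
have e0 : 0 < e by rewrite /e; lra.
have cx : (fun y : X => y ord0 ord0) @ x0 --> x0 ord0 ord0.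
  exact: coord_continuous.
have N1 : \forall y \near x0, (y : X) ord0 ord0 < x0 ord0 ord0 + e / (m + 2).
  have /cvgr_lt := cx; apply; rewrite ltrDl divr_gt0//; lra.
have N2 : \forall y \near x0, S y -> g x0 - e < g y.
  by apply: within_sphere => //; lra.
have [r r0 rN] := nbhs_sqdist (filterI N1 N2).
(* [k] makes the barrier smaller than [min g] at distance [sqrt r] or more
   from [x0]. *)
pose k := 2 * (`|a - g z| + m + 1) / r.
have k0 : 0 <= k by rewrite /k divr_ge0 ?(ltW r0)// mulr_ge0// !addr_ge0// ltW.
pose c := a - k - m * x0 ord0 ord0 - x0 ord0 ord0 ^+ 2.
have [x00 x01] := andP (sphere_coord0 Sx0).
exists (sphere_barrier c k m x0); split.
- exact: smooth_dquad.
- exact: sphere_barrier_strict.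
- move=> x Sx; rewrite sphere_barrierE// /c.
  have [x0' x1'] := andP (sphere_coord0 Sx).
  have sx := sqdist_ge0 x0 x.
  have [xr|rx] := ltP (sqdist x0 x) r.
    have [xe /(_ Sx) gx] := rN _ xr.
    have ks : 0 <= k / 2 * sqdist x0 x by rewrite mulr_ge0// divr_ge0.
    have me : (x ord0 ord0 - x0 ord0 ord0) * (m + 2) <= e.
      by rewrite -ler_pdivlMr; [lra|lra].
    have [d|d] := leP (x ord0 ord0) (x0 ord0 ord0).
      have : a <= g x0 - e by rewrite /e; lra.
      nra.
    have : a + e <= g x0 - e by rewrite /e; lra.
    nra.
  have ks : `|a - g z| + m + 1 <= k / 2 * sqdist x0 x.
    apply: (@le_trans _ _ (k / 2 * r)).
      by rewrite /k -!mulrA [r^-1 * _]mulrCA mulVf ?gt_eqF//; lra.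
    by rewrite ler_wpM2l// divr_ge0.
  have := ler_norm (a - g z); have := zmin _ Sx; nra.
- by rewrite sphere_barrierE// sqdistxx /c; ring.
Qed.

End LowerBarriers.

(** * Perron's method *)

Section Perron.
Context {R : realType} {n : nat}.
Local Notation X := 'rV[R]_n.+1.
Local Notation A := (@touch_region R n).
Local Notation S := (half_sphere R n).
Local Notation D := (closure (half_ball R n)).
Implicit Types (f : R -> R) (g u v q phi : X -> R) (x y z : X) (c : R).

(** The right-hand side [L^*] is upper semicontinuous in the gradient: it jumps
    up only at [0], and is locally constant elsewhere. *)
Lemma strict_at_stable f q x : mean f <= sup (range f) -> smooth q -> A x ->
  strict_at f q x -> \forall y \near x, A y -> strict_at f q y.
Proof.
move=> fM sq Ax [L0 fl].
have lap : \forall y \near x, 0 < laplacian q y.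
  by have /cvgr_gt := @laplacian_continuous _ _ q sq x; apply.
have cp i : continuous (partial i q).
  by apply: smooth_continuous; exact: smooth_partial.
have [[_ x0]|fx] := Ax.
  have pos : \forall y \near x, 0 < (y : X) ord0 ord0.
    by have /cvgr_gt := @coord_continuous R 1 n.+1 ord0 ord0 x; apply.
  near=> y => _; split; first by near: y.
  move=> [_ y0]; suff : 0 < y ord0 ord0 by rewrite y0 ltxx.
  by near: y.
have Lx := fl fx.
have [p0|p0] := eqVneq (tangential_gradient q x) 0.
  have M1 : \forall y \near x, sup (range f) < partial ord0 q y.
    have /cvgr_gt := cp ord0 x; apply.
    by move: Lx; rewrite /Lsup p0 eqxx.
  near=> y => _; split; first by near: y.
  move=> _; apply: (@le_lt_trans _ _ (sup (range f))); last by near: y.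
  by rewrite /Lsup; case: ifP.
have [j pj] : exists j, partial (lift ord0 j) q x != 0.
  apply: contrapT => h; move/eqP: p0; apply.
  apply/rowP => j; rewrite !mxE; apply: contrapT => /eqP jne; apply: h.
  by exists j.
have M1 : \forall y \near x, mean f < partial ord0 q y.
  have /cvgr_gt := cp ord0 x; apply.
  by move: Lx; rewrite /Lsup (negbTE p0).
have M2 : \forall y \near x, partial (lift ord0 j) q y != 0.
  have /cvgr_neq0 := cp (lift ord0 j) x; exact.
near=> y => _; split; first by near: y.
move=> _; rewrite /Lsup; case: eqP => [py|_]; last by near: y.
suff : partial (lift ord0 j) q y != 0.
  by move/rowP: py => /(_ j); rewrite !mxE => ->; rewrite eqxx.
by near: y.
Unshelve. all: by end_near. Qed.

(** Subtracting a small multiple of the squared distance makes touching strict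
    while keeping the gradient at the touching point. *)
Lemma strict_at_perturb f phi x : smooth phi -> strict_at f phi x ->
  exists q eta, [/\ smooth q, 0 < eta, strict_at f q x &
    forall y, q y = phi y - eta * sqdist x y].
Proof.
move=> sphi [L0 fl]; pose eta := laplacian phi x / (4 * n.+1%:R).
have n0 : (0 : R) < 4 * n.+1%:R by rewrite mulr_gt0// ltr0n.
have eta0 : 0 < eta by rewrite divr_gt0.
pose s : X -> R := dquad (- (eta * \sum_i x ord0 i ^+ 2))
  (fun i => 2 * eta * x ord0 i) (fun=> - eta).
have ss : smooth s by exact: smooth_dquad.
have sE y : s y = - (eta * sqdist x y).
  rewrite sqdistE /s /dquad mulrDr opprD; congr (_ + _).
  by rewrite mulr_sumr -sumrN; apply: eq_bigr => i _; ring.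
have ps i : partial i s x = 0 by rewrite partial_dquadE; ring.
have pq i : partial i (phi + s) x = partial i phi x.
  by rewrite partialD// -[RHS]addr0 -(ps i).
exists (phi + s), eta; split.
- exact: smoothD.
- exact: eta0.
- split=> [|/fl].
    rewrite laplacianD// laplacian_dquad sumr_const card_ord.
    have -> : 2 * (- eta *+ n.+1) = - (laplacian phi x / 2).
      rewrite -mulr_natr /eta; field; lra.
    by lra.
  rewrite pq.
  suff -> : tangential_gradient (phi + s) x = tangential_gradient phi x by [].
  by apply/rowP => j; rewrite !mxE pq.
- by move=> y; rewrite -sE.
Qed.

Definition lsc_envelope u x : R :=
  sup [set c | \forall y \near x, A y -> c <= u y].

Section Envelope.
Variables (u psi : X -> R).
Hypothesis psi_cont : continuous psi.
Hypothesis psi_le : forall x, A x -> psi x <= u x.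

Let envelope_has_sup x : A x ->
  has_sup [set c | \forall y \near x, A y -> c <= u y].
Proof.
move=> Ax; split.
  exists (psi x - 1).
  have : \forall y \near x, psi x - 1 < psi y.
    by have /cvgr_gt := @psi_cont x; apply; rewrite ltrBlDr ltrDl.
  by apply: filterS => y py /psi_le; exact/le_trans/ltW.
by exists (u x) => c /nbhs_singleton; exact.
Qed.

Lemma le_envelope x c : A x -> (\forall y \near x, A y -> c <= u y) ->
  c <= lsc_envelope u x.
Proof. by move=> Ax xc; exact: sup_upper_bound (envelope_has_sup Ax) _ xc. Qed.

Lemma envelope_le x : A x -> lsc_envelope u x <= u x.
Proof.
move=> Ax; have [ne _] := envelope_has_sup Ax; apply: ge_sup => // c.
by move=> /nbhs_singleton; exact.
Qed.

Lemma lt_envelope x a : A x -> a < lsc_envelope u x ->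
  \forall y \near x, A y -> a < lsc_envelope u y.
Proof.
move=> Ax ax; have [ne _] := envelope_has_sup Ax.
have [c xc ac] := sup_gt ne ax.
move: (xc) => /nbhs_interior; apply: filterS => y yc Ay.
by apply: lt_le_trans ac _; exact: le_envelope.
Qed.

Lemma le_continuous_envelope q x : continuous q ->
  (forall y, A y -> q y <= u y) -> A x -> q x <= lsc_envelope u x.
Proof.
move=> cq qu Ax; apply/ler_addgt0Pl => e e0; rewrite addrC -lerBlDr.
apply: le_envelope => //.
have : \forall y \near x, q x - e < q y.
  by have /cvgr_gt := cq x; apply; rewrite ltrBlDr ltrDl.
by apply: filterS => y py /qu; exact/le_trans/ltW.
Qed.

Lemma envelope_approx x a (N : set X) : A x -> lsc_envelope u x < a ->
  nbhs x N -> exists y, [/\ A y, N y & u y < a].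
Proof.
move=> Ax xa xN; apply: contrapT => h.
suff : a <= lsc_envelope u x by rewrite leNgt xa.
apply: le_envelope => //; apply: filterS xN => y Ny Ay.
by rewrite leNgt; apply/negP => ua; apply: h; exists y.
Qed.

End Envelope.

Section Minimality.
Variables (f : R -> R) (g : X -> R).
Hypothesis fM : mean f <= sup (range f).
Hypothesis cg : {within S, continuous g}.

Local Notation W := (supersolutions_above f g).
Local Notation u := (inf_supersolution f g).

Lemma exists_lower_barrier : exists psi, [/\ smooth psi,
  forall x, strict_at f psi x & forall x, S x -> psi x <= g x].
Proof.
have [|psi [spsi st psig _]] := @lower_barrier _ _ f g _
  (g (delta_mx ord0 ord0) - 1) cg (@half_sphere_pole R n).
  by rewrite ltrBlDr ltrDl.
by exists psi.
Qed.

Lemma barrier_le_competitor psi v x : smooth psi ->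
  (forall x, strict_at f psi x) -> (forall x, S x -> psi x <= g x) ->
  W v -> D x -> psi x <= v x.
Proof.
move=> spsi st psig [sv gv] Dx.
apply: (strict_le_supersolution sv spsi) => // y Sy.
exact: le_trans (psig _ Sy) (gv _ Sy).
Qed.

Lemma competitors_have_inf x : D x -> has_inf [set v x | v in W].
Proof.
move=> Dx; split.
  by have [v Wv] := exists_competitor f cg; exists (v x); exists v.
have [psi [spsi st psig]] := exists_lower_barrier.
exists (psi x) => _ [v Wv <-]; exact: barrier_le_competitor Wv Dx.
Qed.

Lemma inf_supersolution_le v x : W v -> D x -> u x <= v x.
Proof.
move=> Wv Dx; apply: ge_inf; last by exists v.
by have [] := competitors_have_inf Dx.
Qed.

Lemma le_inf_supersolution a x : D x -> (forall v, W v -> a <= v x) -> a <= u x.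
Proof.
move=> Dx av; have [ne _] := competitors_have_inf Dx.
by apply: lb_le_inf => // _ [v Wv <-]; exact: av.
Qed.

Lemma inf_supersolution_approx a x : D x -> u x < a -> exists2 v, W v & v x < a.
Proof.
move=> Dx /(inf_lt (competitors_have_inf Dx).1)[_ [v Wv <-] va].
by exists v.
Qed.

Lemma barrier_le_inf psi x : smooth psi ->
  (forall x, strict_at f psi x) -> (forall x, S x -> psi x <= g x) ->
  A x -> psi x <= u x.
Proof.
move=> spsi st psig Ax; have Dx := touch_region_closure Ax.
by apply: le_inf_supersolution => // v Wv; exact: barrier_le_competitor Wv Dx.
Qed.

(** Near the sphere, the lower barriers keep the envelope above the data. If a
    test function violated the condition elsewhere, a strictly touching
    perturbation of it would touch, up to a constant, a competitor at a nearby
    point. *)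
Lemma envelope_supersolution :
  supersolution f (patch_sphere (lsc_envelope u) g).
Proof.
have [psi [spsi st psig]] := exists_lower_barrier.
have cpsi := smooth_continuous spsi.
have psiu x : A x -> psi x <= u x by exact: barrier_le_inf.
apply: patch_supersolution => //.
- by move=> x a Ax; exact: lt_envelope cpsi psiu _ _ Ax.
- move=> x a Sx ax; pose b := (a + g x) / 2.
  have [|rho [srho strho rhog rhox]] := @lower_barrier _ _ f g _ b cg Sx.
    by rewrite /b; lra.
  have crho := smooth_continuous srho.
  have : \forall y \near x, a < rho y.
    have /cvgr_gt := crho x; apply.
    by rewrite rhox /b; lra.
  apply: filterS => y ay Ay; apply: lt_le_trans ay _.
  apply: (le_continuous_envelope cpsi psiu) => // z.
  exact: barrier_le_inf.
move=> phi x Ax sphi [e te]; rewrite near_withinE in te.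
apply: contrapT => /not_orP[/negP]; rewrite -ltNge => L0 fl.
have [q [eta [sq eta0 sqx qE]]] : exists q eta, [/\ smooth q, 0 < eta,
    strict_at f q x & forall y, q y = phi y - eta * sqdist x y].
  apply: strict_at_perturb => //; split => // fx.
  by rewrite ltNge; apply/negP => h; apply: fl.
have stq := strict_at_stable fM sq Ax sqx.
have [s s0 sN] := nbhs_sqdist (filterI te (filterI (near_ball Ax) stq)).
pose r := s / 2; have r0 : 0 < r by rewrite divr_gt0.
have rs y : sqdist x y <= r -> sqdist x y < s by rewrite /r; lra.
pose d := eta * r; have d0 : 0 < d by rewrite mulr_gt0.
have qx : q x = lsc_envelope u x by rewrite qE sqdistxx mulr0 subr0.
have cq := smooth_continuous sq.
have Nq : \forall y \near x, q x - d / 2 < q y.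
  by have /cvgr_gt := cq x; apply; lra.
have [|y [Ay [xy qy] uy]] := @envelope_approx u psi cpsi psiu x
  (lsc_envelope u x + d / 2) _ Ax _ (filterI (near_sqdist x r0) Nq).
  by lra.
have [|v Wv vy] := @inf_supersolution_approx (q y + d) y (touch_region_closure Ay).
  by lra.
have [||z zmin zr] := @local_min_in_ball _ _ f v q x r y Wv.1 sq _ Ay (ltW xy).
- by move=> z /rs/sN[_ []].
- move=> z Az zr; have zs : sqdist x z <= r by rewrite zr.
  have [/(_ Az) phiz _] := sN _ (rs _ zs).
  have := envelope_le cpsi psiu Az.
  have := inf_supersolution_le Wv (touch_region_closure Az).
  by rewrite (qE z) zr -/d; lra.
have [_ [_ /(_ zmin.1) stz]] := sN _ (rs _ (ltW zr)).
exact: local_min_not_strict Wv.1 sq zmin stz.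
Qed.

Lemma envelope_competitor : W (patch_sphere (lsc_envelope u) g).
Proof.
split; first exact: envelope_supersolution.
by move=> y Sy; rewrite patch_sphere_out.
Qed.

Lemma inf_supersolution_sphere x : S x -> u x = g x.
Proof.
move=> Sx; apply/eqP; rewrite eq_le; apply/andP; split.
  apply: ge_inf; first by exists (g x) => _ [v [_ gv] <-]; exact: gv.
  exists (patch_sphere (lsc_envelope u) g); first exact: envelope_competitor.
  by rewrite patch_sphere_out.
apply: lb_le_inf => [|_ [v [_ gv] <-]]; last exact: gv.
by have [v Wv] := exists_competitor f cg; exists (v x); exists v.
Qed.

(** The envelope is below the infimum, and above it because it is itself a
    competitor. *)
Lemma inf_supersolutionE x : D x ->
  u x = patch_sphere (lsc_envelope u) g x.
Proof.
move=> Dx; have [Ax|Sx] := closure_half_ball_cases Dx; last first.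
  by rewrite patch_sphere_out// inf_supersolution_sphere.
apply/eqP; rewrite eq_le inf_supersolution_le//=; last exact: envelope_competitor.
rewrite patch_sphere_in//.
have [psi [spsi st psig]] := exists_lower_barrier.
by apply: (envelope_le (smooth_continuous spsi)) => // y; exact: barrier_le_inf.
Qed.

Lemma minimal_inf_supersolution : minimal_supersolution f g u.
Proof.
have [lU tU] := envelope_supersolution.
split.
- split.
    apply/lscP => x a Dx; rewrite inf_supersolutionE// => ax.
    have := (lscP _).1 lU _ _ Dx ax; apply: filterS => y ay Dy.
    by rewrite inf_supersolutionE//; exact: ay.
  move=> phi x Ax sphi [e te]; apply: tU => //; split.
    by rewrite -inf_supersolutionE//; exact: touch_region_closure.
  rewrite near_withinE in te; rewrite near_withinE.
  apply: filterS te => y ty Ay; rewrite -inf_supersolutionE; first exact: ty.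
  exact: touch_region_closure.
- exact: inf_supersolution_sphere.
- by move=> v Wv x Dx; exact: inf_supersolution_le.
Qed.

End Minimality.

End Perron.

(** * The mean of a non-constant periodic function *)

Section Mean.
Context {R : realType}.
Implicit Types (f : R -> R) (alpha : R).

Lemma holder_continuous alpha f : holder_class alpha f -> continuous f.
Proof.
move=> [[|k] [beta [_ /andP[beta0 _] df [C fC]]]] x; last first.
  have := df 0%N isT x; rewrite /derive1n /= => dfx.
  exact/differentiable_continuous/derivable1_diffP.
rewrite /derive1n /= in fC.
apply/cvgrPdist_lt => e e0.
pose r := (e / (`|C| + 1)) `^ beta^-1.
have C0 : 0 < `|C| + 1 by rewrite ltr_wpDl.
have r0 : 0 < r by rewrite powR_gt0// divr_gt0.
near=> y.
have xy : `|x - y| < r by near: y; exact: cvgr_dist_lt.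
apply: le_lt_trans (fC _ _) _.
apply: (@le_lt_trans _ _ ((`|C| + 1) * `|x - y| `^ beta)).
  by rewrite ler_wpM2r ?powR_ge0// (le_trans (ler_norm _))// lerDl.
rewrite mulrC -ltr_pdivlMr//.
have -> : e / (`|C| + 1) = r `^ beta.
  by rewrite -powRrM mulVf ?gt_eqF// powRr1// divr_ge0// ltW.
by rewrite gt0_ltr_powR// nnegrE// ltW.
Unshelve. all: by end_near. Qed.

Lemma periodic_fract f x : periodic f 1 ->
  exists2 y, 0 <= y < 1 & f y = f x.
Proof.
move=> fp; have fz (z : int) a : f (a + z%:~R) = f a.
  case: z => m; first exact: (periodicn fp m a).
  by rewrite NegzE mulrNz; have := periodicn fp m.+1 (a - m.+1%:R); rewrite subrK => ->.
exists (x - (Num.floor x)%:~R); last by rewrite -mulrNz fz.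
by rewrite subr_ge0 floor_le/= ltrBlDl -[1]/(1%:~R) -intrD floorD1_gt.
Qed.

Lemma periodic_has_sup f : continuous f -> periodic f 1 -> has_sup (range f).
Proof.
move=> cf fp; split; first by exists (f 0); exists 0.
have [c _ cmax] := EVT_max ler01 (continuous_subspaceT cf).
exists (f c) => _ [x _ <-]; have [y /andP[y0 y1] <-] := periodic_fract x fp.
by apply: cmax; rewrite in_itv/= y0 ltW.
Qed.

(** If the mean were the maximum, the primitive of [max f - f], which is
    nondecreasing, would vanish at both ends of the period. *)
Lemma mean_lt_sup f : continuous f -> periodic f 1 ->
  ~ (exists c, forall x, f x = c) -> mean f < sup (range f).
Proof.
move=> cf fp nf; set M := sup (range f).
have fM x : f x <= M.
  by apply: sup_upper_bound; [exact: periodic_has_sup|exists x].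
have [x0 fx0] : exists x, f x < M.
  apply: contrapT => h; apply: nf; exists M => x; apply/eqP.
  rewrite eq_le fM/= leNgt; apply/negP => fx; apply: h; by exists x.
have [y /andP[y0 y1] fy] := periodic_fract x0 fp.
have [t /andP[t0 t1] ft] : exists2 t, 0 < t < 1 & f t < M.
  have fyM : f y < M by rewrite fy.
  have N1 : \forall t \near y^'+, f t < M.
    by apply: cvg_within; have /cvgr_lt := cf y; apply.
  near y^'+ => t; exists t; last by near: t.
  apply/andP; split; last by near: t; exact: nbhs_right_lt.
  by apply: le_lt_trans y0 _; near: t; exact: nbhs_right_gt.
pose mu := @lebesgue_measure R.
pose h x := M - f x.
have ch : continuous h by move=> x; exact: cvgB (cvg_cst M) (cf x).
have ih (g : R -> R) : continuous g -> mu.-integrable `[0, 1] (EFin \o g).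
  move=> cg; apply: continuous_compact_integrable; first exact: segment_compact.
  exact: continuous_subspaceT.
pose G x := \int[mu]_(s in `[0, x]) h s.
have G1 : G 1 = M - mean f.
  rewrite /G /h /mean RintegralB//; [|exact/ih/cst_continuous|exact: ih].
  rewrite Rintegral_cst//= lebesgue_measure_itv/= lte_fin ltr01.
  by rewrite oppr0 adde0/= mulr1.
rewrite -subr_gt0 -G1 ltNge; apply/negP => G10.
have G0 x : 0 <= x <= 1 -> G x = 0.
  move=> /andP[xge0 xle1]; apply/eqP; rewrite eq_le; apply/andP; split; last first.
    by apply: Rintegral_ge0 => s _; rewrite subr_ge0.
  apply: le_trans G10; rewrite -subr_ge0 /G Rintegral_itvB//; last first.
    exact: ih.
  by apply: Rintegral_ge0 => s _; rewrite subr_ge0.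
have [dG] := @continuous_FTC1_closed R h 0 t 1 t1 (ih _ ch) t0 (ch t).
rewrite -/mu -/G => Gt.
suff : derive1 G t = 0 by rewrite Gt /h; lra.
rewrite derive1E (near_eq_derive (g := cst 0)) ?derive_cst//.
near=> s; apply: G0; apply/andP; split; apply: ltW; near: s.
  exact: lt_nbhsr.
exact: lt_nbhsl.
Unshelve. all: by end_near. Qed.

End Mean.

(** * Data with a contact point *)

Section ContactData.
Context {R : realType} {n : nat}.
Local Notation X := 'rV[R]_n.+1.
Local Notation A := (@touch_region R n).
Local Notation S := (half_sphere R n).
Local Notation D := (closure (half_ball R n)).
Implicit Types (f : R -> R) (g u : X -> R) (x y z : X).

(** [e + (<f> + e) x_1 + (2 n + 1) e x_1^2 - 2 e |x'|^2]: for [e > 0], a strict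
    subsolution of the Neumann problem of slope [<f>], positive at the centre of
    the flat ball and negative on its rim. *)
Definition bump f (e : R) : X -> R := dquad e
  (fun i => (mean f + e) *+ (i == ord0))
  (fun i => if i == ord0 then (2 * n + 1)%:R * e else - (2 * e)).

Lemma laplacian_bump f e x : laplacian (bump f e) x = 2 * e.
Proof.
rewrite laplacian_dquad big_ord_recl eqxx.
rewrite (eq_bigr (fun=> - (2 * e))); last by [].
rewrite sumr_const card_ord natrD natrM -mulr_natr; ring.
Qed.

Lemma bump0 f e : bump f e 0 = e.
Proof.
rewrite /bump /dquad big1 ?addr0// => i _.
by rewrite mxE expr0n !mulr0 addr0.
Qed.

Lemma bump_sphere f e x : S x -> bump f e x =
  (mean f + e) * x ord0 ord0 - e + (2 * n + 3)%:R * e * x ord0 ord0 ^+ 2.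
Proof.
move=> [/enorm_eq1 + _]; rewrite sqdist0E big_ord_recl => x1.
rewrite /bump /dquad big_ord_recl eqxx mulr1n.
rewrite (eq_bigr (fun j => - (2 * e) * x ord0 (lift ord0 j) ^+ 2)); last first.
  by move=> j _; rewrite mulr0n mul0r add0r.
rewrite -mulr_sumr; move/(canRL (addKr _)): x1 => ->.
by rewrite (natrD _ (2 * n) 1) (natrD _ (2 * n) 3); ring.
Qed.

Definition gap f : R := (sup (range f) - mean f) / (2 * n + 4)%:R.

Lemma gap_gt0 f : mean f < sup (range f) -> 0 < gap f.
Proof. by move=> fM; rewrite divr_gt0 ?subr_gt0// ltr0n addnS. Qed.

(** The excess slope [max f - <f>] of the saturated function absorbs the
    quadratic growth of the bump in [x_1], whose size is chosen for that. *)
Lemma bump_le_saturated f x : mean f < sup (range f) -> S x ->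
  bump f (gap f) x <= saturated f (- gap f) x.
Proof.
move=> fM Sx; have e0 := gap_gt0 fM; rewrite bump_sphere// /saturated.
have /andP[x0 x1] := sphere_coord0 Sx.
have Me : sup (range f) = mean f + (2 * n + 4)%:R * gap f.
  by rewrite /gap mulrC divfK ?pnatr_eq0 ?addnS// addrC subrK.
rewrite Me (natrD _ (2 * n) 4) (natrD _ (2 * n) 3).
set N := (2 * n)%:R; have N0 : 0 <= N :> R by rewrite ler0n.
have xx : x ord0 ord0 ^+ 2 <= x ord0 ord0 by nra.
have : (N + 3%:R) * gap f * x ord0 ord0 ^+ 2 <= (N + 3%:R) * gap f * x ord0 ord0.
  by apply: ler_wpM2l => //; rewrite mulr_ge0 ?(ltW e0)// addr_ge0.
lra.
Qed.

(** The solution lies below the saturated function, hence below the bump at the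
    origin; where the difference is smallest, the bump touches, and its slope
    there exceeds [<f>]. *)
Lemma contact_set_nonempty f g : mean f < sup (range f) ->
  {within S, continuous g} ->
  (forall x, S x -> bump f (gap f) x <= g x <= saturated f 0 x) ->
  contact_set f (inf_supersolution f g) !=set0.
Proof.
move=> fM cg gb; set u := inf_supersolution f g.
have [su ug umin] := minimal_inf_supersolution (ltW fM) cg.
have e0 := gap_gt0 fM; set psi := bump f (gap f).
have spsi : smooth psi by exact: smooth_dquad.
have A0 : A 0 by apply/touch_regionP; rewrite sqdistxx mxE.
have D0 := touch_region_closure A0.
have u0 : u 0 <= 0.
  have -> : 0 = patch_sphere (saturated f 0) g 0 :> R.
    by rewrite patch_sphere_in// /saturated mxE mulr0 addr0.
  apply: umin => //; apply: saturated_competitor => // x Sx.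
  by case/andP: (gb _ Sx).
have [||z Dz zmin] := min_on_compact su (smooth_continuous spsi)
  (@compact_closure_half_ball R n).
- by [].
- by exists 0.
have zneg : u z - psi z < 0.
  by apply: le_lt_trans (zmin _ D0) _; rewrite /psi bump0; lra.
have Az : A z.
  have [//|Sz] := closure_half_ball_cases Dz; move: zneg.
  by rewrite /u ug// subr_lt0 ltNge; case/andP: (gb _ Sz) => ->.
have lm : local_min u psi z.
  by split => //; near=> y => /touch_region_closure; exact: zmin.
have [|fz _] := local_min_flat su spsi lm.
  by rewrite laplacian_bump mulr_gt0.
exists z; split => //; exists (psi + cst (u z - psi z)); split.
- by apply: smoothD => //; exact: smooth_cst.
- exact: local_min_touches.
- rewrite partial_add_cst// partial_dquadE eqxx mulr1n.
  by case: fz => _ ->; rewrite mulr0 addr0 ltrDl.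
Unshelve. all: by end_near. Qed.

Lemma near_uniform g (e : R) : 0 < e ->
  nbhs (g : {uniform` S -> R}) [set h | forall x, S x -> `|g x - h x| < e].
Proof.
move=> e0; apply/uniform_nbhs.
exists [set xy | `|xy.1 - xy.2| < e]; split; last by move=> h.
exact: (@entourage_ball R R (PosNum e0)).
Qed.

End ContactData.

Theorem proposition1p4 (R : realType) (n : nat) (n_gt0 : (0 < n)%N)
    (alpha : R) (alpha_gt0 : 0 < alpha)
    (f : R -> R) (f_holder : holder_class alpha f)
    (f_periodic : periodic f 1)
    (f_nonconstant : ~ exists c : R, forall x, f x = c) :
  exists F : set {uniform` half_sphere R n -> R},
    [/\ F !=set0,
        F `<=` boundary_data R n,
        open (F : set (subspace (boundary_data R n))) &
        forall g, F g ->
          [/\ minimal_supersolution f g (inf_supersolution f g),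
              contact_set f (inf_supersolution f g) !=set0 &
              open (contact_set f (inf_supersolution f g)
                      : set (subspace (flat_ball R n)))]].
Proof.
have fM := mean_lt_sup (holder_continuous f_holder) f_periodic f_nonconstant.
have e0 := @gap_gt0 R n f fM; set e := gap f in e0.
(* On the half sphere [g0] is [e / 2] below the upper barrier and at least
   [e / 2] above the lower one, which leaves room for an error [e / 2]. *)
pose g0 : {uniform` half_sphere R n -> R} := saturated f (- (e / 2)).
pose U := [set h : {uniform` half_sphere R n -> R} |
  forall x, half_sphere R n x -> `|g0 x - h x| < e / 2].
exists (boundary_data R n `&` interior U); split.
- exists g0; split.
    by apply: continuous_subspaceT; exact: saturated_continuous.
  by apply: near_uniform; rewrite divr_gt0.
- by move=> g [].
- by rewrite setIC open_subspaceIT; apply: open_subspaceW; exact: open_interior.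
move=> g [cg /interior_subset gU].
have msup := minimal_inf_supersolution (ltW fM) cg.
have [su _ _] := msup.
split=> //; last exact: contact_set_open su.
apply: contact_set_nonempty => // x Sx.
have := bump_le_saturated fM Sx; have := gU _ Sx.
rewrite -/e /g0 /saturated ltr_norml => /andP[? ?] ?; apply/andP; split; lra.
Qed.
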